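(* Let $X$ be a nonempty completely regular space, $\mu$ a $\sigma$-finite Borel measure on $X$ with support equal to the whole of $X$, $E\ne\{0\}$ a Banach space with dual $E^\ast$, and $D=L^1_\mu(X,E)$. Let $A=C(X,L(E))\subset L(D)$ act by multiplication, $(af)(x)=a(x)f(x)$. Let $G$ be a discrete group, $\{t_g\}_{g\in G}$ a group of homeomorphisms of $X$ ($t_{gh}=t_g\circ t_h$) preserving the equivalence class of $\mu$, and let $T_g$ be the isometry of $D$ given by $$(T_gf)(x)=\frac{d\,t_g^{-1}(\mu)}{d\mu}(x)\,f(t_g^{-1}(x)).$$ If $G$ acts topologically freely on $X$, then for every nonempty finite $F\subset G$ and all $a_g\in A$ ($g\in F$) $$\Big\|\sum_{g\in F}a_gT_g\Big\|=\sup_{x\in X}\ \sup_{\{f_g\}_{g\in F}\in S_F(E^\ast)}\Big\|\sum_{g\in F}[a_g(t_g(x))]^\ast f_g\Big\|=\sup_{x\in X}\ \sup_{\{f_g\}_{g\in F}\in B_F(E^\ast)}\Big\|\sum_{g\in F}[a_g(t_g(x))]^\ast f_g\Big\|,$$ where the norm on the left is the operator norm in $L(D)$ and $[a_g(t_g(x))]^\ast\in L(E^\ast)$ is the adjoint of $a_g(t_g(x))\in L(E)$.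
   Context: All Banach spaces are complex, completely regular spaces are Hausdorff. $L(E)$ is the algebra of bounded linear operators on $E$; $C(X,B)$ is the space of bounded continuous functions $X\to B$ with the sup norm; $L^1_\mu(X,E)$ is the Bochner space. $t_g^{-1}(\mu)$ denotes the measure $Q\mapsto\mu(t_g^{-1}(Q))$; preserving the equivalence class of $\mu$ means that for each $g\in G$ this measure is absolutely continuous with respect to $\mu$. For a finite set $F\subset G$ and a Banach space $Y$: $B_F(Y)=\{\{f_g\}_{g\in F}: f_g\in Y,\ \|f_g\|\le1 \text{ for all } g\in F\}$ and $S_F(Y)=\{\{f_g\}_{g\in F}: f_g\in Y,\ \|f_g\|=1\text{ for all } g\in F\}$. $G$ acts topologically freely if for every $g\in G$, $g\neq e$, the set $\{x\in X:t_g(x)=x\}$ has empty interior. *)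

(* Defs.v *)
From HB Require Import structures.
From mathcomp Require Import all_boot all_order all_algebra finmap.
From mathcomp Require Import complex.
From mathcomp Require Import all_classical all_reals all_analysis.
From mathcomp Require Import measurable_realfun.

Set Implicit Arguments.
Unset Strict Implicit.
Unset Printing Implicit Defensive.

Import Order.TTheory GRing.Theory Num.Theory.
Import numFieldNormedType.Exports.

Local Open Scope classical_set_scope.
Local Open Scope ring_scope.
Local Open Scope complex_scope.

(* In a normed space over R[i] the library norm takes values in R[i];
   rnorm is the same number, seen in R. *)
Definition rnorm {R : realType} {V : normedModType R[i]} (v : V) : R :=
  complex.Re `|v|.

Section rnorm_theory.
Context {R : realType} {V : normedModType R[i]}.
Implicit Types v w : V.

Lemma rnormE v : `|v| = (rnorm v)%:C.
Proof. by rewrite /rnorm RRe_real// ger0_real. Qed.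

Lemma rnorm_ge0 v : 0 <= rnorm v.
Proof. by rewrite -lecR -rnormE; exact: normr_ge0. Qed.

Lemma rnorm0 : rnorm (0 : V) = 0.
Proof. by rewrite /rnorm normr0. Qed.

Lemma rnorm_eq0 v : rnorm v = 0 -> v = 0.
Proof. by move=> v0; apply/normr0_eq0; rewrite rnormE v0. Qed.

Lemma rnormD v w : rnorm (v + w) <= rnorm v + rnorm w.
Proof. by rewrite -lecR rmorphD/= -!rnormE ler_normD. Qed.

Lemma rnormZ (c : R[i]) v : rnorm (c *: v) = rnorm (c : R[i]^o) * rnorm v.
Proof.
by apply: complexI; rewrite rmorphM/= -!rnormE normrZ.
Qed.

Lemma rnormN v : rnorm (- v) = rnorm v.
Proof. by rewrite /rnorm normrN. Qed.

Lemma rnormB v w : rnorm v - rnorm w <= rnorm (v - w).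
Proof. by rewrite lerBlDr (le_trans _ (rnormD _ _))// subrK. Qed.

End rnorm_theory.

Section bounded_operators.
Context {R : realType}.

Definition bounded_linear (V W : normedModType R[i]) : {pred (V -> W)} :=
  fun f => `[< linear f /\ exists M : R, forall v, rnorm (f v) <= M * rnorm v >].

Lemma bounded_linear_submod (V W : normedModType R[i]) :
  GRing.submod_closed (@bounded_linear V W).
Proof.
split=> [|c f g].
  apply/asboolP; split=> [c u v|]; first by rewrite /= scaler0 addr0.
  by exists 0 => v; rewrite rnorm0 mul0r.
move=> /asboolP[lf [M fM]] /asboolP[lg [N gN]]; apply/asboolP; split.
  move=> d u v; rewrite /= !fctE/= lf lg !scalerDr !scalerA.
  by rewrite (mulrC c d) !addrA; congr (_ + _); rewrite addrAC.
exists (rnorm (c : R[i]^o) * M + N) => v; rewrite !fctE/=.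
rewrite (le_trans (rnormD _ _))// mulrDl lerD// rnormZ -mulrA.
by rewrite ler_wpM2l// rnorm_ge0.
Qed.

HB.instance Definition _ (V W : normedModType R[i]) :=
  GRing.isSubmodClosed.Build R[i] (V -> W) (@bounded_linear V W)
    (bounded_linear_submod V W).

(* The space L(V, W) of bounded linear operators, normed by opnorm below. *)
Record bop (V W : normedModType R[i]) := Bop {
  bop_fun :> V -> W ;
  bop_funP : bop_fun \in @bounded_linear V W }.

HB.instance Definition _ (V W : normedModType R[i]) :=
  [isSub for @bop_fun V W].
HB.instance Definition _ (V W : normedModType R[i]) :=
  [Choice of bop V W by <:].
HB.instance Definition _ (V W : normedModType R[i]) :=
  [SubChoice_isSubLmodule of bop V W by <:].

Lemma bop_linear (V W : normedModType R[i]) (f : bop V W) : linear f.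
Proof. by have /asboolP[] := bop_funP f. Qed.

HB.instance Definition _ (V W : normedModType R[i]) (f : bop V W) :=
  GRing.isLinear.Build R[i] V W *:%R f (bop_linear f).

Lemma bop_bounded (V W : normedModType R[i]) (f : bop V W) :
  exists2 M : R, 0 <= M & forall v, rnorm (f v) <= M * rnorm v.
Proof.
have /asboolP[_ [M fM]] := bop_funP f; exists (Num.max M 0).
  by rewrite le_max lexx orbT.
move=> v; rewrite (le_trans (fM v))// ler_wpM2r// ?rnorm_ge0//.
by rewrite le_max lexx.
Qed.

Lemma bopP (V W : normedModType R[i]) (f g : bop V W) : f =1 g -> f = g.
Proof. by move=> fg; apply/val_inj/funext. Qed.

Lemma bop0E (V W : normedModType R[i]) v : (0 : bop V W) v = 0.
Proof. by []. Qed.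

Lemma bopDE (V W : normedModType R[i]) (f g : bop V W) v :
  (f + g) v = f v + g v.
Proof. by []. Qed.

Lemma bopNE (V W : normedModType R[i]) (f : bop V W) v : (- f) v = - f v.
Proof. by []. Qed.

Lemma bopBE (V W : normedModType R[i]) (f g : bop V W) v :
  (f - g) v = f v - g v.
Proof. by []. Qed.

Lemma bopZE (V W : normedModType R[i]) c (f : bop V W) v :
  (c *: f) v = c *: f v.
Proof. by []. Qed.

Lemma bop_sumE (V W : normedModType R[i]) I (r : seq I) (P : pred I)
    (f : I -> bop V W) v :
  (\sum_(i <- r | P i) f i) v = \sum_(i <- r | P i) f i v.
Proof. by elim/big_rec2: _ => //= i x y _ <-. Qed.

Definition opnorm (V W : normedModType R[i]) (f : bop V W) : R :=
  sup [set rnorm (f v) | v in [set v : V | rnorm v <= 1]].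

Section opnorm_theory.
Context {V W : normedModType R[i]}.
Implicit Types f g : bop V W.

Lemma opnorm_has_sup f :
  has_sup [set rnorm (f v) | v in [set v : V | rnorm v <= 1]].
Proof.
split; first by exists (rnorm (f 0)), 0 => //=; rewrite rnorm0 ler01.
have [M M0 fM] := bop_bounded f; exists M => _ [v /= v1 <-].
by rewrite (le_trans (fM v))// ler_piMr.
Qed.

Lemma le_opnorm1 f v : rnorm v <= 1 -> rnorm (f v) <= opnorm f.
Proof.
by move=> v1; apply: sup_upper_bound; [exact: opnorm_has_sup|exists v].
Qed.

Lemma opnorm_ge0 f : 0 <= opnorm f.
Proof.
by rewrite (le_trans _ (@le_opnorm1 f 0 _))// ?rnorm_ge0// rnorm0 ler01.
Qed.

Lemma opnorm_le f (M : R) :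
  (forall v, rnorm v <= 1 -> rnorm (f v) <= M) -> opnorm f <= M.
Proof.
move=> fM; apply: ge_sup; first by have [] := opnorm_has_sup f.
by move=> _ [v /= v1 <-]; exact: fM.
Qed.

Lemma rnormZr (a : R) (v : V) : rnorm (a%:C *: v) = `|a| * rnorm v.
Proof.
by apply: complexI; rewrite rmorphM/= -!rnormE normrZ normc_def/= expr0n/= addr0 sqrtr_sqr.
Qed.

Lemma le_opnorm f v : rnorm (f v) <= opnorm f * rnorm v.
Proof.
have [/rnorm_eq0 ->|v0] := eqVneq (rnorm v) 0.
  by rewrite linear0 !rnorm0 mulr0.
have vgt0 : 0 < rnorm v by rewrite lt_def v0 rnorm_ge0.
rewrite -ler_pdivrMr// mulrC.
have -> : (rnorm v)^-1 * rnorm (f v) = rnorm (f ((rnorm v)^-1%:C *: v)).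
  apply: complexI; rewrite linearZ rmorphM/= -!rnormE normrZ.
  by rewrite normc_def/= expr0n/= addr0 sqrtr_sqr ger0_norm// invr_ge0 ltW.
apply: le_opnorm1.
by rewrite rnormZr ger0_norm ?invr_ge0 ?rnorm_ge0// mulVf.
Qed.

Lemma opnormD f g : (opnorm (f + g))%:C <= (opnorm f)%:C + (opnorm g)%:C.
Proof.
rewrite -rmorphD/= lecR; apply: opnorm_le => v v1.
by rewrite bopDE (le_trans (rnormD _ _))// lerD// le_opnorm1.
Qed.

Lemma opnormZ (c : R[i]) f : (opnorm (c *: f))%:C = `|c| * (opnorm f)%:C.
Proof.
have cE : `|c| = (rnorm (c : R[i]^o))%:C by rewrite -rnormE.
rewrite cE -rmorphM/=; congr (_%:C); apply/eqP; rewrite eq_le; apply/andP; split.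
  apply: opnorm_le => v v1.
  by rewrite bopZE rnormZ ler_wpM2l ?rnorm_ge0// le_opnorm1.
have [c0|c0] := eqVneq (rnorm (c : R[i]^o)) 0.
  by rewrite c0 mul0r opnorm_ge0.
rewrite -ler_pdivlMl ?lt_def ?c0 ?rnorm_ge0//; apply: opnorm_le => v v1.
rewrite ler_pdivlMl ?lt_def ?c0 ?rnorm_ge0// -rnormZ.
exact: (le_opnorm1 (c *: f)).
Qed.

Lemma opnorm_eq0 f : (opnorm f)%:C = 0 -> f = 0.
Proof.
move=> /complexI f0; apply: bopP => v; apply: rnorm_eq0; apply/eqP.
by rewrite eq_le rnorm_ge0 andbT (le_trans (le_opnorm f v))// f0 mul0r.
Qed.

End opnorm_theory.

HB.instance Definition _ (V W : normedModType R[i]) :=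
  @Lmodule_isNormed.Build R[i] (bop V W) (fun f => (opnorm f)%:C)
    opnormD opnormZ opnorm_eq0.

Lemma rnorm_bopE (V W : normedModType R[i]) (f : bop V W) :
  rnorm f = opnorm f.
Proof. by []. Qed.

Lemma comp_bop_subproof (U V W : normedModType R[i]) (f : bop V W)
  (g : bop U V) : (f \o g) \in @bounded_linear U W.
Proof.
apply/asboolP; split=> [c u v|]; first by rewrite /= !linearP.
exists (opnorm f * opnorm g) => v /=.
by rewrite (le_trans (le_opnorm _ _))// -mulrA ler_wpM2l ?opnorm_ge0 ?le_opnorm.
Qed.

Definition comp_bop (U V W : normedModType R[i]) (f : bop V W) (g : bop U V)
  : bop U W := Bop (comp_bop_subproof f g).

Definition dual (V : normedModType R[i]) := bop V R[i]^o.

HB.instance Definition _ (V : normedModType R[i]) := NormedModule.on (dual V).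

Definition adjoint_fun (V W : normedModType R[i]) (f : bop V W)
    : dual W -> dual V := fun phi => comp_bop phi f.

Lemma adjoint_subproof (V W : normedModType R[i]) (f : bop V W) :
  (adjoint_fun f) \in @bounded_linear (dual W) (dual V).
Proof.
apply/asboolP; split=> [c u v|]; first by apply: bopP.
exists (opnorm f) => phi; apply: opnorm_le => v v1 /=.
rewrite mulrC (le_trans (le_opnorm _ _))// ler_wpM2l ?opnorm_ge0//.
exact: le_opnorm1.
Qed.

Definition adjoint (V W : normedModType R[i]) (f : bop V W)
  : bop (dual W) (dual V) := Bop (adjoint_subproof f).

End bounded_operators.

Section rnorm_cvg.
Context {R : realType} {V : normedModType R[i]}.

Lemma cvg_rnormP (I : Type) (F : set_system I) (FF : Filter F) (f : I -> V) l :
  f @ F --> l <-> forall e : R, 0 < e -> \forall x \near F, rnorm (l - f x) < e.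
Proof.
split=> [/cvgrPdist_lt fl e e0|fl].
  have /fl : 0 < e%:C by rewrite ltcR.
  by apply: filterS => x; rewrite rnormE ltcR.
apply/cvgrPdist_lt => e e0.
have eE : e = (complex.Re e)%:C by rewrite RRe_real// gtr0_real.
have /fl : 0 < complex.Re e by rewrite -ltcR -eE.
by apply: filterS => x; rewrite rnormE [e in _ -> _ < e]eE ltcR.
Qed.

Lemma cvg_rnorm (I : Type) (F : set_system I) (FF : Filter F) (f : I -> V) l :
  f @ F --> l -> rnorm (f x) @[x --> F] --> rnorm l.
Proof.
move=> /cvg_rnormP fl; apply/cvgrPdist_lt => e e0.
apply: filterS (fl _ e0) => x; apply: le_lt_trans.
rewrite ler_norml rnormB andbT lerNl opprB.
by rewrite -[rnorm (l - _)]rnormN opprB rnormB.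
Qed.

End rnorm_cvg.

Section strong_measurability.
Context d (T : measurableType d).

Definition simple_function (V : Type) (s : T -> V) :=
  finite_set (range s) /\ forall v, measurable (s @^-1` [set v]).

(* Everywhere limits of simple functions suffice: a mu-almost everywhere limit
   of simple functions agrees almost everywhere with such a function, and
   bochnerL1 is taken modulo equality almost everywhere. *)
Definition strongly_measurable (V : topologicalType) (f : T -> V) :=
  exists2 s : nat -> T -> V, (forall n, simple_function (s n)) &
    forall x, s n x @[n --> \oo] --> f x.

Lemma simple_finite V (s : T -> V) : simple_function s -> finite_set (range s).
Proof. by case. Qed.

Lemma simple_fiber V (s : T -> V) v :
  simple_function s -> measurable (s @^-1` [set v]).
Proof. by case. Qed.

Lemma simple_preimage V (s : T -> V) (A : set V) :
  simple_function s -> measurable (s @^-1` A).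
Proof.
move=> [fs ms].
have -> : s @^-1` A = \bigcup_(v in range s `&` A) s @^-1` [set v].
  apply/seteqP; split=> [x Ax|x [v [_ Av] /= sx]]; last by rewrite sx.
  by exists (s x) => //; split => //; exists x.
by apply: fin_bigcup_measurable => //; exact: finite_setIl.
Qed.

Lemma simple_comp V W (phi : V -> W) (s : T -> V) :
  simple_function s -> simple_function (phi \o s).
Proof.
move=> ss; split=> [|w].
  rewrite -(image_comp s phi setT); apply: finite_image.
  exact: (simple_finite ss).
by rewrite comp_preimage; exact: simple_preimage.
Qed.

Lemma simple_pair V W (s : T -> V) (t : T -> W) :
  simple_function s -> simple_function t ->
  simple_function (fun x => (s x, t x)).
Proof.
move=> ss st; split=> [|[v w]].
  apply: (@sub_finite_set _ _ (range s `*` range t)).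
    by move=> _ [x _ <-]; split; exists x.
  by apply: finite_setX; exact: simple_finite.
have -> : (fun x => (s x, t x)) @^-1` [set (v, w)] =
    s @^-1` [set v] `&` t @^-1` [set w].
  by apply/seteqP; split=> [x [<- <-]//|x [/= -> ->]].
by apply: measurableI; exact: simple_fiber.
Qed.

Lemma strongly_measurable_cst (V : topologicalType) (v : V) :
  strongly_measurable (fun _ : T => v).
Proof.
exists (fun _ _ => v) => [n|x]; last exact: cvg_cst.
split=> [|w].
  by apply: (@sub_finite_set _ _ [set v]) => // _ [x _ <-].
have [->|vw] := pselect (v = w).
  by rewrite (_ : _ @^-1` _ = setT)//; apply/seteqP; split.
by rewrite (_ : _ @^-1` _ = set0)//; apply/seteqP; split.
Qed.

Lemma strongly_measurable_comp2 (U V W : topologicalType)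
    (phi : U * V -> W) (f : T -> U) (g : T -> V) :
  continuous phi -> strongly_measurable f -> strongly_measurable g ->
  strongly_measurable (fun x => phi (f x, g x)).
Proof.
move=> cphi [s ss sf] [t st tg].
exists (fun n x => phi (s n x, t n x)) => [n|x].
  exact/(simple_comp phi)/simple_pair.
apply: (@cvg_comp _ _ _ (fun n => (s n x, t n x)) phi); last exact: cphi.
by apply: cvg_pair; [exact: sf|exact: tg].
Qed.

Lemma strongly_measurable_comp1 (V W : topologicalType)
    (phi : V -> W) (f : T -> V) :
  continuous phi -> strongly_measurable f -> strongly_measurable (phi \o f).
Proof.
move=> cphi [s ss sf]; exists (fun n => phi \o s n) => [n|x].
  exact: simple_comp.
by apply: (@cvg_comp _ _ _ (s ^~ x) phi); [exact: sf|exact: cphi].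
Qed.

Context {R : realType}.

Lemma measurable_rnorm (V : normedModType R[i]) (f : T -> V) :
  strongly_measurable f -> measurable_fun setT (fun x => rnorm (f x)).
Proof.
move=> [s ss sf]; apply: (@measurable_fun_cvg _ _ _ _ (fun n x => rnorm (s n x))).
  move=> n _ A _; rewrite setTI.
  by have := simple_preimage A (simple_comp (@rnorm R V) (ss n)).
by move=> x _; apply: cvg_rnorm; exact: sf.
Qed.

Lemma simple_ffun (I : finType) (b : I -> T -> bool) :
  (forall i, measurable (b i @^-1` [set true])) ->
  simple_function (fun x => [ffun i => b i x]).
Proof.
move=> mb; split; first exact: finite_finset.
move=> v.
have -> : (fun x => [ffun i => b i x]) @^-1` [set v] =
    \bigcap_(i in [set: I]) (b i @^-1` [set v i]).
  apply/seteqP; split=> [x <- i _ /=|x h]; first by rewrite ffunE.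
  by apply/ffunP => i; rewrite ffunE; apply: h.
apply: fin_bigcap_measurable; first exact: finite_finset.
move=> i _; case: (v i) => //.
rewrite (_ : _ @^-1` _ = ~` (b i @^-1` [set true])); first exact: measurableC.
by apply/seteqP; split=> x /=; case: (b i x).
Qed.

Lemma strongly_measurable_separable (V : normedModType R[i]) (f : T -> V)
    (c : nat -> V) :
  (forall v e, measurable [set x | rnorm (v - f x) < e]) ->
  (forall x e, 0 < e -> exists n, rnorm (c n - f x) < e) ->
  strongly_measurable f.
Proof.
move=> mf cf.
pose b (n : nat) (i : 'I_n.+1 * 'I_n.+1) (x : T) :=
  rnorm (c i.1 - f x) < i.2.+1%:R^-1.
pose best n (w : {ffun 'I_n.+1 * 'I_n.+1 -> bool}) : V :=
  if [pick i | w i] is Some i0 then c [arg max_(i > i0 | w i) i.2].1 else c 0%N.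
exists (fun n x => best n [ffun i => b n i x]) => [n|x].
  apply: (simple_comp (best n)); apply: simple_ffun => i.
  rewrite (_ : _ @^-1` _ = [set x | rnorm (c i.1 - f x) < i.2.+1%:R^-1])//.
apply/cvg_rnormP => e e0.
have [m me] : exists m : nat, m.+1%:R^-1 < e.
  have [m /= _ /(_ _ (leqnn m))] := near_infty_natSinv_lt (PosNum e0).
  by exists m.
have [|k ck] := cf x m.+1%:R^-1; first by rewrite invr_gt0 ltr0n.
near=> n.
have kn : (k < n.+1)%N by rewrite ltnS; near: n; exact: nbhs_infty_ge.
have mn : (m < n.+1)%N by rewrite ltnS; near: n; exact: nbhs_infty_ge.
rewrite /best; case: pickP => [i0 wi0|/(_ (Ordinal kn, Ordinal mn))]; last first.
  by rewrite ffunE /b/= ck.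
case: arg_maxnP => // i; rewrite ffunE => bi /(_ (Ordinal kn, Ordinal mn)).
rewrite ffunE /b/= ck => /(_ isT) mi.
rewrite -rnormN opprB (lt_trans bi)// (le_lt_trans _ me)//.
by rewrite lef_pV2 ?posrE ?ltr0n// ler_nat.
Unshelve. all: by end_near. Qed.

End strong_measurability.

Section bochner_L1.
Context d (T : measurableType d) (R : realType).
Variables (mu : {measure set T -> \bar R}) (E : normedModType R[i]).

Definition bochner_integrable : {pred (T -> E)} := fun f =>
  `[< strongly_measurable f /\ (\int[mu]_x (rnorm (f x))%:E < +oo)%E >].

Lemma measurable_EFin_rnorm (f : T -> E) : strongly_measurable f ->
  measurable_fun setT (fun x => (rnorm (f x))%:E).
Proof. by move=> mf; apply/measurable_EFinP; exact: measurable_rnorm. Qed.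

Lemma bochner_integrable_submod : GRing.submod_closed bochner_integrable.
Proof.
split=> [|c f g].
  apply/asboolP; split; first exact: strongly_measurable_cst.
  rewrite integral0_eq// => x _; congr (_%:E).
  exact: rnorm0.
move=> /asboolP[mf fi] /asboolP[mg gi]; apply/asboolP; split.
  apply: (@strongly_measurable_comp2 _ _ E E E (fun p => c *: p.1 + p.2)) => //.
  move=> p; apply: cvgD; last exact: cvg_snd.
  by apply: cvgZr; exact: cvg_fst.
have mcf := measurable_EFin_rnorm mf.
have mcg := measurable_EFin_rnorm mg.
apply: (@le_lt_trans _ _ (\int[mu]_x ((rnorm (c : R[i]^o))%:E *
    (rnorm (f x))%:E + (rnorm (g x))%:E))%E).
  apply: ge0_le_integral => //.
  - by move=> x _; rewrite lee_fin rnorm_ge0.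
  - apply: measurable_EFin_rnorm.
    apply: (@strongly_measurable_comp2 _ _ E E E (fun p => c *: p.1 + p.2)) => //.
    move=> p; apply: cvgD; last exact: cvg_snd.
    by apply: cvgZr; exact: cvg_fst.
  - by apply: emeasurable_funD => //; exact: measurable_funeM.
  - by move=> x _; rewrite lee_fin (le_trans (rnormD _ _))// rnormZ.
rewrite ge0_integralD//; first last.
- by move=> x _; rewrite lee_fin rnorm_ge0.
- exact: measurable_funeM.
- by move=> x _; rewrite mule_ge0// lee_fin rnorm_ge0.
rewrite ge0_integralZl_EFin//; last 2 first.
- by move=> x _; rewrite lee_fin rnorm_ge0.
- exact: rnorm_ge0.
by rewrite lte_add_pinfty// lte_mul_pinfty// lee_fin rnorm_ge0.
Qed.

HB.instance Definition _ :=
  GRing.isSubmodClosed.Build R[i] (T -> E) bochner_integrable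
    bochner_integrable_submod.

Record bochner := Bochner {
  bochner_fun :> T -> E ;
  bochner_funP : bochner_fun \in bochner_integrable }.

HB.instance Definition _ := [isSub for bochner_fun].
HB.instance Definition _ := [Choice of bochner by <:].
HB.instance Definition _ := [SubChoice_isSubLmodule of bochner by <:].

Lemma bochner_strongly_measurable (f : bochner) : strongly_measurable f.
Proof. by have /asboolP[] := bochner_funP f. Qed.

Lemma bochner_integral_lty (f : bochner) :
  (\int[mu]_x (rnorm (f x))%:E < +oo)%E.
Proof. by have /asboolP[] := bochner_funP f. Qed.

Lemma bochner_measurable_rnorm (f : bochner) :
  measurable_fun setT (fun x => (rnorm (f x))%:E).
Proof. by apply: measurable_EFin_rnorm; exact: bochner_strongly_measurable. Qed.

Lemma bochner_integral_fin_num (f : bochner) :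
  (\int[mu]_x (rnorm (f x))%:E)%E \is a fin_num.
Proof.
rewrite ge0_fin_numE ?bochner_integral_lty//.
by apply: integral_ge0 => x _; rewrite lee_fin rnorm_ge0.
Qed.

Definition bochner_null : {pred bochner} := fun f =>
  `[< {ae mu, forall x, f x = 0} >].

Lemma bochner_null_zmod : GRing.zmod_closed bochner_null.
Proof.
split=> [|f g /asboolP f0 /asboolP g0].
  by apply/asboolP; exact: aeW.
apply/asboolP; apply: filterS2 f0 g0 => x.
by rewrite -[(f - g) x]/(f x - g x) => -> ->; rewrite subrr.
Qed.

HB.instance Definition _ :=
  GRing.isZmodClosed.Build bochner bochner_null bochner_null_zmod.

Definition bochnerL1 := Quotient.quot bochner_null.

HB.instance Definition _ := GRing.Zmodule.on bochnerL1.
HB.instance Definition _ := EqQuotient.on bochnerL1.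

Definition L1class (f : bochner) : bochnerL1 :=
  (\pi_bochnerL1 f)%qT.

Lemma L1classP (F : bochnerL1) : exists f, F = L1class f.
Proof. by exists (repr F); rewrite /L1class reprK. Qed.

Lemma L1class_eq (f g : bochner) :
  L1class f = L1class g <-> {ae mu, forall x, f x = g x}.
Proof.
have -> : (L1class f = L1class g) <-> f - g \in bochner_null.
  by rewrite (@Quotient.idealrBE bochner bochner_null); split=> /eqP.
split=> [/asboolP|fg]; last (apply/asboolP; move: fg).
  apply: filterS => x; rewrite -[(f - g) x]/(f x - g x) => /eqP.
  by rewrite subr_eq0 => /eqP.
apply: filterS => x fg; rewrite -[(f - g) x]/(f x - g x) fg subrr//.
Qed.

Lemma repr_L1class (f : bochner) : {ae mu, forall x, repr (L1class f) x = f x}.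
Proof. by apply/L1class_eq; rewrite /L1class reprK. Qed.

Lemma L1classD (f g : bochner) : L1class (f + g) = L1class f + L1class g.
Proof. exact: raddfD. Qed.

Definition L1scale (c : R[i]) (F : bochnerL1) : bochnerL1 :=
  L1class (c *: repr F).

Lemma L1classZ c (f : bochner) : L1scale c (L1class f) = L1class (c *: f).
Proof.
apply/L1class_eq; apply: filterS (repr_L1class f) => x fx.
by rewrite -[(c *: f) x]/(c *: f x) -fx.
Qed.

Let L1scaleA a b F : L1scale a (L1scale b F) = L1scale (a * b) F.
Proof. by have [f ->] := L1classP F; rewrite !L1classZ scalerA. Qed.

Let L1scale1 : left_id 1 L1scale.
Proof. by move=> F; have [f ->] := L1classP F; rewrite L1classZ scale1r. Qed.

Let L1scaleDr : right_distributive L1scale +%R.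
Proof.
move=> c F G; have [[f ->] [g ->]] := (L1classP F, L1classP G).
by rewrite -L1classD !L1classZ scalerDr L1classD.
Qed.

Let L1scaleDl F : {morph L1scale ^~ F : a b / a + b}.
Proof.
move=> a b; have [f ->] := L1classP F.
by rewrite !L1classZ scalerDl L1classD.
Qed.

HB.instance Definition _ := GRing.Zmodule_isLmodule.Build R[i] bochnerL1
  L1scaleA L1scale1 L1scaleDr L1scaleDl.

Lemma L1class_is_linear : linear L1class.
Proof. by move=> c f g; rewrite L1classD -L1classZ. Qed.

HB.instance Definition _ := GRing.isLinear.Build R[i] bochner bochnerL1 *:%R
  L1class L1class_is_linear.

Definition L1norm (F : bochnerL1) : R :=
  fine (\int[mu]_x (rnorm (repr F x))%:E).

Lemma L1norm_classE (f : bochner) :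
  (L1norm (L1class f))%:E = (\int[mu]_x (rnorm (f x))%:E)%E.
Proof.
rewrite /L1norm fineK ?bochner_integral_fin_num//.
apply: ae_eq_integral => //; try exact: bochner_measurable_rnorm.
by apply: filterS (repr_L1class f) => x -> _.
Qed.

Lemma L1normD (F G : bochnerL1) :
  (L1norm (F + G))%:C <= (L1norm F)%:C + (L1norm G)%:C.
Proof.
have [[f ->] [g ->]] := (L1classP F, L1classP G).
rewrite -L1classD -rmorphD lecR -lee_fin EFinD !L1norm_classE.
rewrite -ge0_integralD//; try exact: bochner_measurable_rnorm;
  try by move=> x _; rewrite lee_fin rnorm_ge0.
apply: ge0_le_integral => //; try exact: bochner_measurable_rnorm.
- by move=> x _; rewrite lee_fin rnorm_ge0.
- by apply: emeasurable_funD; exact: bochner_measurable_rnorm.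
- by move=> x _; rewrite -EFinD lee_fin; exact: rnormD.
Qed.

Lemma L1normZ (c : R[i]) (F : bochnerL1) :
  (L1norm (c *: F))%:C = `|c| * (L1norm F)%:C.
Proof.
have [f ->] := L1classP F.
have -> : `|c| = (rnorm (c : R[i]^o))%:C by rewrite -rnormE.
rewrite -rmorphM -linearZ; congr (_%:C); apply: EFin_inj.
rewrite EFinM !L1norm_classE -ge0_integralZl_EFin ?rnorm_ge0//; last 2 first.
- by move=> x _; rewrite lee_fin rnorm_ge0.
- exact: bochner_measurable_rnorm.
by apply: eq_integral => x _; rewrite -EFinM -rnormZ.
Qed.

Lemma L1norm_eq0 (F : bochnerL1) : (L1norm F)%:C = 0 -> F = 0.
Proof.
have [f ->] := L1classP F => /complexI f0.
have : (\int[mu]_x `|(rnorm (f x))%:E| = 0)%E.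
  rewrite -[RHS](congr1 EFin f0) L1norm_classE; apply: eq_integral => x _.
  by rewrite gee0_abs// lee_fin rnorm_ge0.
move/(ae_eq_integral_abs mu measurableT (bochner_measurable_rnorm f)) => f0E.
rewrite -(linear0 L1class); apply/L1class_eq.
apply: filterS f0E => x /(_ I) fx0; apply: rnorm_eq0.
exact: EFin_inj fx0.
Qed.

HB.instance Definition _ := @Lmodule_isNormed.Build R[i] bochnerL1
  (fun F => (L1norm F)%:C) L1normD L1normZ L1norm_eq0.

Lemma rnorm_L1class (f : bochner) :
  (rnorm (L1class f))%:E = (\int[mu]_x (rnorm (f x))%:E)%E.
Proof. exact: L1norm_classE. Qed.

End bochner_L1.

Section countable_chain_condition.
Context d (T : measurableType d) (R : realType).
Variable mu : {measure set T -> \bar R}.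
Hypothesis sfmu : sigma_finite setT mu.

Lemma countable_disjoint (I : pointedType) (D : set I) (F : I -> set T) :
  (forall i, D i -> measurable (F i)) -> (forall i, D i -> 0 < mu (F i))%E ->
  trivIset D F -> countable D.
Proof.
move=> mF F0 tF; have [A TA mA] := sfmu.
have -> : D = \bigcup_n \bigcup_k
    [set i | D i /\ (k.+1%:R^-1%:E < mu (F i `&` A n))%E].
  apply/seteqP; split=> [i Di|i [n _ [k _ []//]]].
  have [n nA] : exists n, (0 < mu (F i `&` A n))%E.
    apply: contrapT => /forallNP h; have := F0 _ Di; apply/negP; rewrite -leNgt.
    have -> : F i = \bigcup_n (F i `&` A n) by rewrite -setI_bigcupr -TA setIT.
    have : mu.-negligible (\bigcup_n (F i `&` A n)).
      apply: negligible_bigcup => n.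
      apply/negligibleP; first by apply: measurableI; [exact: mF|exact: (mA n).1].
      by apply/eqP; rewrite -measure_le0 leNgt; exact/negP/h.
    move/negligibleP => ->//; apply: bigcup_measurable => n _.
    by apply: measurableI; [exact: mF|exact: (mA n).1].
  have [r r0 rF] : exists2 r : R, 0 < r & (r%:E < mu (F i `&` A n))%E.
    have [f|] := boolP (mu (F i `&` A n) \is a fin_num); last first.
      by rewrite ge0_fin_numE// -leNgt leye_eq => /eqP ->; exists 1; rewrite ?ltry.
    exists (fine (mu (F i `&` A n)) / 2).
      by rewrite divr_gt0// fine_gt0// nA -ge0_fin_numE.
    rewrite -[ltRHS]fineK// lte_fin gtr_pMr ?invf_lt1 ?ltr1n//.
    by rewrite fine_gt0// nA -ge0_fin_numE.
  exists n => //; have [k _ /(_ _ (leqnn k))/= kr] := near_infty_natSinv_lt (PosNum r0).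
  by exists k => //; split=> //; rewrite (lt_trans _ rF)// lte_fin.
apply: bigcup_countable => // n _; apply: bigcup_countable => // k _.
apply: finite_set_countable; apply: contrapT.
move=> /infiniteP/pcard_leP/injfunPex[/= q q_fun q_inj].
have [mAn An_fin] := mA n.
have qD j : D (q j) by have [] := q_fun j Logic.I.
have mq j : measurable (F (q j) `&` A n) by apply: measurableI => //; exact: mF.
have tq : trivIset setT (fun j => F (q j) `&` A n).
  apply/trivIsetP => i j _ _ ij; rewrite setIACA.
  move/trivIsetP : tF => -> //; first by rewrite set0I.
  by apply: contra_neq ij => /q_inj; apply; rewrite inE.
have : (\sum_(0 <= j <oo) mu (F (q j) `&` A n) <= mu (A n))%E.
  have <- : mu (\bigcup_j (F (q j) `&` A n)) =
      (\sum_(0 <= j <oo) mu (F (q j) `&` A n))%E.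
    rewrite measure_bigcup//.
    by apply: eq_eseriesl => j; rewrite in_setT.
  apply: le_measure; rewrite ?inE//; first exact: bigcup_measurable.
  by apply: bigcup_sub => j _; exact: subIsetr.
apply/negP; rewrite -ltNge.
pose N := (Num.truncn (fine (mu (A n)) * k.+1%:R)).+1.
have AfE : (fine (mu (A n)))%:E = mu (A n).
  by rewrite fineK// ge0_fin_numE.
apply: (lt_le_trans _ (nneseries_lim_ge N _)) => //.
apply: (@lt_le_trans _ _ (\sum_(0 <= j < N) k.+1%:R^-1%:E)%E); last first.
  by apply: lee_sum => j _; have [_ /ltW] := q_fun j Logic.I.
rewrite sumEFin sumr_const_nat subn0 -AfE lte_fin -[ltRHS]mulr_natl.
rewrite ltr_pdivlMr ?ltr0n//; exact: truncnS_gt.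
Qed.

End countable_chain_condition.

Definition borel (X : ptopologicalType) := g_sigma_algebraType (@open X).

HB.instance Definition _ (X : ptopologicalType) := Measurable.on (borel X).

Section borel.
Context {R : realType} {X : ptopologicalType}.

Lemma open_borel (U : set X) : open U -> measurable (U : set (borel X)).
Proof. by move=> oU; apply: sub_sigma_algebra. Qed.

Lemma continuous_borel (u : X -> X) : continuous u ->
  measurable_fun setT (u : borel X -> borel X).
Proof.
move=> cu; apply: (@measurability _ _ (borel X) (borel X) setT u (@open X)) => // _ [U oU <-].
by rewrite setTI; apply: open_borel; move/continuousP : cu; apply.
Qed.

Definition msupport (mu : set (borel X) -> \bar R) : set X :=
  [set x | forall U : set X, open U -> U x -> (0 < mu U)%E].

(* Since the support of the sigma-finite measure mu is X, disjoint families of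
   nonempty open sets are countable, so a has separable range. *)
Lemma strongly_measurable_continuous (mu : {sigma_finite_measure set (borel X) -> \bar R})
    (V : normedModType R[i]) (a : X -> V) :
  msupport mu = setT -> continuous a ->
  @strongly_measurable _ (borel X) V a.
Proof.
move=> smu ca.
have oball v e : open [set x | rnorm (v - a x) < e].
  apply: (@open_comp _ _ (fun x => rnorm (v - a x)) [set r | r < e]); last first.
    exact: open_lt.
  move=> x _; apply: cvg_rnorm; apply: cvgB; [exact: cvg_cst|exact: ca].
have dense_e (e : R) : 0 < e ->
    exists D : set X, countable D /\
      forall x, exists2 y, D y & rnorm (a y - a x) < e.
  move=> e0; have e20 : 0 < e / 2 by rewrite divr_gt0.
  pose B y := [set x | rnorm (a y - a x) < e / 2].
  have [D [_ tD maxD]] := ex_maximal_disjoint_subcollection B [set: X].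
  exists D; split.
    apply: (@countable_disjoint _ (borel X) R mu (sigma_finiteT mu) X D B) => //.
    - by move=> y _; apply: open_borel; exact: oball.
    - move=> y _; have : msupport mu y by rewrite smu.
      by apply; [exact: oball|rewrite /B/= subrr rnorm0].
  move=> x; apply: contrapT => /forall2NP h.
  have Dx : ~ D x.
    by move=> Dx; have [//|] := h x; rewrite subrr rnorm0.
  apply: (maxD (D `|` [set x])) => //.
    rewrite properEneq; split; last exact: subsetUl.
    by apply/eqP => DE; apply: Dx; rewrite DE; right.
  have key y : D y -> B y `&` B x = set0.
    move=> Dy; apply/seteqP; split=> // z [/= yz xz].
    have [//|] := h y; apply.
    rewrite (_ : a y - a x = (a y - a z) - (a x - a z)); last first.
      by rewrite opprB addrA subrK.
    rewrite (le_lt_trans (rnormD _ _))// rnormN (splitr e) ltrD//.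
  apply/trivIsetP => y z [Dy|->] [Dz|->] yz; last by rewrite eqxx in yz.
  - by move/trivIsetP : tD; apply.
  - exact: key.
  - by rewrite setIC; exact: key.
have /choice[D /all_and2[cD dD]] : forall n : nat, exists D : set X,
    countable D /\ forall x, exists2 y, D y & rnorm (a y - a x) < n.+1%:R^-1.
  by move=> n; apply: dense_e; rewrite invr_gt0 ltr0n.
have : countable (\bigcup_n D n) by exact: bigcup_countable.
move=> /pfcard_geP[D0|[q]].
  have [y Dy _] := dD 0%N point.
  by have : (\bigcup_n D n) y by [exists 0%N]; rewrite D0.
apply: (@strongly_measurable_separable _ (borel X) R V a (a \o q)).
  by move=> v e; apply: open_borel; exact: oball.
move=> x e e0; have [n _ /(_ _ (leqnn n))/= ne] := near_infty_natSinv_lt (PosNum e0).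
have [y Dy yx] := dD n x.
have [k _ qk] : (q @` setT) y by apply: (@surj _ _ _ _ q); exists n.
by exists k; rewrite /= qk (lt_trans yx).
Qed.

End borel.

Section density.
Local Open Scope ereal_scope.
Context d (T : measurableType d) (R : realType).

Definition is_density (nu mu : set T -> \bar R) (rho : T -> R) :=
  [/\ measurable_fun setT rho, (forall x, 0 <= rho x)%R &
    forall A, measurable A -> nu A = \int[mu]_(x in A) (rho x)%:E].

(* A version of the Radon-Nikodym derivative of nu with respect to mu; the
   library's 'd nu '/d mu is restricted to finite nu. *)
Definition RNderiv (nu mu : set T -> \bar R) : T -> R :=
  xget (fun=> 0%R) [set rho | is_density nu mu rho].

Lemma density_exists (mu : {sigma_finite_measure set T -> \bar R})
    (nu : {measure set T -> \bar R}) :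
  sigma_finite setT nu -> nu `<< mu -> exists rho, is_density nu mu rho.
Proof.
move=> [F TF /all_and2[mF nuFoo]] /null_content_dominatesP numu.
pose E := seqDU F.
have mE k : measurable (E k).
  by apply: measurableD => //; exact: bigsetU_measurable.
have nuEoo k : nu (E k) < +oo.
  by rewrite (le_lt_trans _ (nuFoo k))// le_measure ?inE//; exact: subDsetl.
have UET : \bigcup_i E i = [set: T] by rewrite TF [RHS]seqDU_bigcup_eq.
have tE := trivIset_seqDU F.
pose nu_ j : {finite_measure set T -> \bar R} := mfrestr (mE j) (nuEoo j).
have numu_ k : nu_ k `<< mu.
  apply/null_content_dominatesP => S mS muS0; rewrite /nu_/= /mfrestr /mrestr.
  apply: numu; first exact: measurableI.
  apply/eqP; rewrite -measure_le0 -muS0 le_measure ?inE//.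
  exact: measurableI.
have [g_] := choice (fun j => radon_nikodym_sigma_finite (numu_ j)).
move=> /all_and4[g_ge0 g_fin ig_ int_gE].
have mg_ k : measurable_fun setT (g_ k) by have /integrableP[] := ig_ k.
have /choice[kk kkE] : forall x, exists k, E k x.
  by move=> x; have : setT x by []; rewrite -UET => -[k _ Ekx]; exists k.
have kkP k x : E k x -> kk x = k.
  move=> Ekx; apply/eqP/negP => /negP kxk.
  move/trivIsetP : tE => /(_ _ _ Logic.I Logic.I kxk) EE0.
  by have : (E (kk x) `&` E k) x by []; rewrite EE0.
pose rho x := fine (g_ (kk x) x).
have mrho : measurable_fun setT rho.
  move=> _ B mB; rewrite setTI.
  have -> : rho @^-1` B = \bigcup_k (E k `&` (fine \o g_ k) @^-1` B).
    apply/seteqP; split=> [x Bx|x [k _ [Ekx]]]; first by exists (kk x).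
    by rewrite /= /rho (kkP _ _ Ekx).
  apply: bigcup_measurable => k _; apply: measurableI => //.
  rewrite -[X in measurable X]setTI.
  have /(_ measurableT B mB) : measurable_fun setT (fine \o g_ k).
    by apply: measurableT_comp => //; exact: mg_.
  by [].
have rho0 x : (0 <= rho x)%R by rewrite fine_ge0.
exists rho; split => // A mA.
have AE : A = \bigcup_k (A `&` E k) by rewrite -setI_bigcupr UET setIT.
have mAE k : measurable (A `&` E k) by exact: measurableI.
have tAE : trivIset setT (fun k => A `&` E k) by exact: trivIset_setIl.
rewrite [in RHS]AE ge0_integral_bigcup//; last 2 first.
- by apply: measurable_funTS; exact/measurable_EFinP.
- by move=> x _; rewrite lee_fin.
rewrite [in LHS]AE measure_bigcup//.
rewrite (@eq_eseriesl _ _ xpredT); last by move=> j; rewrite in_setT.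
apply: eq_eseriesr => k _.
transitivity (nu_ k A); first by [].
transitivity (nu_ k (A `&` E k)).
  by rewrite /nu_/= /mfrestr/= /mrestr -setIA setIid.
rewrite int_gE//; apply: eq_integral => x; rewrite inE => -[_ Ekx].
by rewrite /rho (kkP _ _ Ekx) fineK.
Qed.

Lemma RNderivP (mu : {sigma_finite_measure set T -> \bar R})
    (nu : {measure set T -> \bar R}) :
  sigma_finite setT nu -> nu `<< mu -> is_density nu mu (RNderiv nu mu).
Proof.
move=> sfnu numu; have [rho hrho] := density_exists sfnu numu.
by rewrite /RNderiv; case: xgetP => [r _ //|/(_ rho)].
Qed.

Import HBNNSimple.

Lemma density_change_of_variables (mu nu : {measure set T -> \bar R}) rho
    (f : T -> \bar R) : is_density nu mu rho ->
    (forall x, 0 <= f x) -> measurable_fun setT f ->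
  \int[mu]_x (f x * (rho x)%:E) = \int[nu]_x f x.
Proof.
move=> [mrho rho0 rhoE] f0 mf; set g := EFin \o rho.
have g_ge0 x : 0 <= g x by rewrite /g lee_fin.
have mg : measurable_fun setT g by exact/measurable_EFinP.
have mE := @measurableT _ T; set E := [set: T] in mE *.
pose h := nnsfun_approx mE mf.
have -> : \int[nu]_(x in E) f x =
    lim (\int[nu]_(x in E) (EFin \o h n) x @[n --> \oo]).
  have fE x : E x -> f x = lim ((EFin \o h n) x @[n --> \oo]).
    by move=> Ex; apply/esym/cvg_lim => //; exact: cvg_nnsfun_approx.
  under eq_integral => x /[!inE] /fE -> //.
  apply: monotone_convergence => //.
  - move=> n; apply/measurable_EFinP.
    by apply: (measurable_funS measurableT) => //; exact/measurable_funP.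
  - by move=> n x Ex //=; rewrite lee_fin.
  - by move=> x Ex a b ab; rewrite lee_fin; exact/lefP/nd_nnsfun_approx.
have -> : \int[mu]_(x in E) (f \* g) x =
    lim (\int[mu]_(x in E) ((EFin \o h n) \* g) x @[n --> \oo]).
  have fg x : E x -> f x * g x = lim (((EFin \o h n) \* g) x @[n --> \oo]).
    by move=> Ex; apply/esym/cvg_lim => //; apply: cvgeZr => //;
      exact: cvg_nnsfun_approx.
  under eq_integral => x /[!inE] /fg -> //.
  apply: monotone_convergence => [//| | |].
  - move=> n; apply/emeasurable_funM; apply/measurable_funTS => //.
    exact/measurable_EFinP.
  - by move=> n x Ex /=; rewrite mule_ge0 ?lee_fin.
  - move=> x Ex a b ab/=; rewrite lee_wpmul2r ?lee_fin//.
    exact/lefP/nd_nnsfun_approx.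
suff suf n : \int[mu]_(x in E) ((EFin \o h n) x * g x) =
    \int[nu]_(x in E) (EFin \o h n) x.
  by under eq_fun do rewrite suf.
transitivity (\int[nu]_(x in E)
   (\sum_(y \in range (h n)) (y * \1_(h n @^-1` [set y]) x)%:E)); last first.
  by apply: eq_integral => t tE; rewrite /= fimfunE -fsumEFin.
have indich m r : measurable_fun E (fun x => (r * \1_(h m @^-1` [set r]) x)%:E).
  by apply: (measurable_comp measurableT) => //; exact: measurable_funM.
rewrite ge0_integral_fsum//; last by move=> m y Ey; exact: nnfun_muleindic_ge0.
transitivity (\int[mu]_(x in E) (\sum_(y \in range (h n))
    (y * \1_(h n @^-1` [set y]) x)%:E * g x)).
  under [RHS]eq_integral => x xE.
    rewrite -ge0_mule_fsuml => [|y]; last exact: nnfun_muleindic_ge0.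
    rewrite fsumEFin // -(fimfunE _ x); over.
  by [].
rewrite ge0_integral_fsum//; last 2 first.
  - by move=> y; apply: emeasurable_funM => //; exact: measurable_funTS.
  - by move=> m y Ey; rewrite mule_ge0 ?g_ge0// nnfun_muleindic_ge0.
apply: eq_fsbigr => r rhn.
under [RHS]eq_integral do rewrite EFinM.
rewrite integralZl_indic_nnsfun => //.
under eq_integral do rewrite EFinM -muleA.
rewrite ge0_integralZl//.
- under eq_integral do rewrite muleC.
  rewrite (eq_integral (g \_ (h n @^-1` [set r]))); last first.
    by move=> x xE; rewrite epatch_indic.
  by rewrite -integral_mkcondr -rhoE// integral_indic// setIC.
- apply: emeasurable_funM; first exact/measurable_EFinP.
  exact/measurable_funTS.
- by move=> t Et; rewrite mule_ge0 ?lee_fin ?g_ge0.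
- by move: rhn; rewrite inE => -[t _ <-]; rewrite lee_fin.
Qed.

End density.

Section multiplication.
Context {R : realType} {X : ptopologicalType}.

(* C(X, B) *)
Record Cb (B : normedModType R[i]) := MkCb {
  Cb_fun :> X -> B ;
  Cb_continuous : continuous Cb_fun ;
  Cb_bounded : exists M : R, forall x, rnorm (Cb_fun x) <= M }.

Lemma bop_eval_continuous (V W : normedModType R[i]) :
  continuous (fun p : bop V W * V => p.1 p.2).
Proof.
move=> [A v]; apply/cvg_rnormP => e e0 /=.
pose M := opnorm A + 1 + rnorm v.
have M0 : 0 < M by rewrite /M -addrA addrCA ltr_pwDl// addr_ge0 ?opnorm_ge0 ?rnorm_ge0.
pose dlt := Num.min 1 (e / (M + 1)).
have M10 : 0 < M + 1 by rewrite addr_gt0.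
have dlt0 : 0 < dlt by rewrite lt_min ltr01/= divr_gt0.
have cA : p.1 @[p --> (A, v)] --> A by exact: cvg_fst.
have cv : p.2 @[p --> (A, v)] --> v by exact: cvg_snd.
move/cvg_rnormP : cA => /(_ dlt dlt0) nA.
move/cvg_rnormP : cv => /(_ dlt dlt0) nv.
near=> p.
have HA : rnorm (A - p.1) < dlt by near: p; exact: nA.
have Hv : rnorm (v - p.2) < dlt by near: p; exact: nv.
have -> : A v - p.1 p.2 = (A - p.1) v + p.1 (v - p.2).
  by rewrite bopBE linearB addrA subrK.
have p1 : rnorm p.1 <= opnorm A + 1.
  rewrite -[p.1](subrKC A) (le_trans (rnormD _ _))// lerD// -rnormN opprB.
  by rewrite (le_trans (ltW HA))// ge_min lexx.
rewrite (le_lt_trans (rnormD _ _))//.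
rewrite (@le_lt_trans _ _ (dlt * M))//.
  rewrite /M [leRHS]mulrDr addrC lerD//.
    rewrite (le_trans (le_opnorm _ _))// mulrC ler_pM ?rnorm_ge0 ?opnorm_ge0//.
    exact: ltW.
  by rewrite (le_trans (le_opnorm _ _))// ler_wpM2r ?rnorm_ge0// ltW.
rewrite (@le_lt_trans _ _ (e / (M + 1) * M))//.
  by rewrite ler_wpM2r ?(ltW M0)// ge_min lexx orbT.
by rewrite -mulrA gtr_pMr// mulrC ltr_pdivrMr// mul1r ltrDl.
Unshelve. all: by end_near. Qed.

Variable mu : {sigma_finite_measure set (borel X) -> \bar R}.
Hypothesis smu : msupport mu = setT.
Variable E : normedModType R[i].

Lemma mul_bochner_subproof (a : Cb (bop E E)) (f : bochner mu E) :
  (fun x => a x (f x)) \in @bochner_integrable _ _ _ mu E.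
Proof.
have ma : strongly_measurable (fun x : borel X => a x (f x)).
  apply: (@strongly_measurable_comp2 _ (borel X) (bop E E) E E
    (fun p => p.1 p.2) a f).
  - exact: bop_eval_continuous.
  - exact: (strongly_measurable_continuous smu (@Cb_continuous _ a)).
  - exact: bochner_strongly_measurable.
apply/asboolP; split=> //.
have [M aM] := Cb_bounded a.
have M0 : 0 <= M by rewrite (le_trans _ (aM point)) ?rnorm_ge0.
apply: (@le_lt_trans _ _ (\int[mu]_x (M%:E * (rnorm (f x))%:E))%E).
  apply: ge0_le_integral => //.
  - by move=> x _; rewrite lee_fin rnorm_ge0.
  - exact: measurable_EFin_rnorm.
  - by apply: measurable_funeM; exact: bochner_measurable_rnorm.
  - move=> x _; rewrite -EFinM lee_fin (le_trans (le_opnorm _ _))//.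
    by rewrite ler_wpM2r ?rnorm_ge0//; exact: aM.
rewrite ge0_integralZl_EFin//.
- by rewrite lte_mul_pinfty ?bochner_integral_lty// lee_fin.
- by move=> x _; rewrite lee_fin rnorm_ge0.
- exact: bochner_measurable_rnorm.
Qed.

Definition mul_bochner (a : Cb (bop E E)) (f : bochner mu E) : bochner mu E :=
  Bochner (mul_bochner_subproof a f).

(* The value on a class does not depend on the representative
   (mul_L1_classE). *)
Definition mul_L1 (a : Cb (bop E E)) (F : bochnerL1 mu E) : bochnerL1 mu E :=
  L1class (mul_bochner a (repr F)).

Lemma mul_L1_classE (a : Cb (bop E E)) (f : bochner mu E) :
  mul_L1 a (L1class f) = L1class (mul_bochner a f).
Proof. by apply/L1class_eq; apply: filterS (repr_L1class f) => x /= ->. Qed.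

Lemma mul_L1_subproof (a : Cb (bop E E)) :
  mul_L1 a \in @bounded_linear _ (bochnerL1 mu E) (bochnerL1 mu E).
Proof.
apply/asboolP; split=> [c F G|].
  have [[f ->] [g ->]] := (L1classP F, L1classP G).
  rewrite -linearP !mul_L1_classE -linearP; congr L1class.
  by apply/val_inj/funext => x /=; exact: linearP.
have [M aM] := Cb_bounded a; exists M => F.
have M0 : 0 <= M by rewrite (le_trans _ (aM point)) ?rnorm_ge0.
have [f ->] := L1classP F; rewrite mul_L1_classE.
rewrite -lee_fin EFinM !rnorm_L1class -ge0_integralZl_EFin//; last 2 first.
- by move=> x _; rewrite lee_fin rnorm_ge0.
- exact: bochner_measurable_rnorm.
apply: ge0_le_integral => //.
- by move=> x _; rewrite lee_fin rnorm_ge0.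
- exact: bochner_measurable_rnorm.
- by apply: measurable_funeM; exact: bochner_measurable_rnorm.
- move=> x _; rewrite -EFinM lee_fin (le_trans (le_opnorm _ _))//.
  by rewrite ler_wpM2r ?rnorm_ge0//; exact: aM.
Qed.

Definition mulop (a : Cb (bop E E)) : bop (bochnerL1 mu E) (bochnerL1 mu E) :=
  Bop (mul_L1_subproof a).

End multiplication.

Arguments Cb {R} X B.

Section group_action.
Context {X : ptopologicalType} {G : groupType}.

Definition homeomorphism (u : X -> X) :=
  continuous u /\ exists v, [/\ continuous v, cancel u v & cancel v u].

Definition homeomorphism_group (t : G -> X -> X) :=
  (forall g, homeomorphism (t g)) /\
  (forall g h, t (g * h)%g = t g \o t h).

Definition topologically_free (t : G -> X -> X) :=
  forall g, g != 1%g -> [set x | t g x = x]^° = set0.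

Lemma homeomorphism_group1 t : homeomorphism_group t -> t 1%g = id.
Proof.
move=> [ht tM]; apply/funext => x; have [_ [v [_ tv _]]] := ht 1%g.
by apply: (can_inj tv); rewrite -[LHS]/((t 1%g \o t 1%g) x) -tM mulg1.
Qed.

Lemma homeomorphism_groupK t g : homeomorphism_group t ->
  cancel (t g) (t g^-1%g).
Proof.
move=> ht x; rewrite -[LHS]/((t g^-1%g \o t g) x) -ht.2 mulVg.
by rewrite homeomorphism_group1.
Qed.

Lemma homeomorphism_groupVK t g : homeomorphism_group t ->
  cancel (t g^-1%g) (t g).
Proof. by move=> /homeomorphism_groupK -/(_ g^-1%g); rewrite invgK. Qed.

Context {R : realType}.

Definition preserves_class (mu : set (borel X) -> \bar R) (t : G -> X -> X) :=
  forall g, pushforward mu (t g : borel X -> borel X) `<< mu.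

End group_action.

Section shift.
Context {R : realType} {X : ptopologicalType} {G : groupType}.
Variables (mu : {sigma_finite_measure set (borel X) -> \bar R}).
Variables (t : G -> X -> X) (ht : homeomorphism_group t).
Hypothesis tmu : preserves_class mu t.
Variable E : normedModType R[i].

(* d t_g^-1(mu) / d mu, where t_g^-1(mu) is the measure Q |-> mu(t_g^-1(Q)) *)
Definition jacobian (g : G) : X -> R :=
  RNderiv (pushforward mu (t g : borel X -> borel X)) mu.

Lemma action_measurable g : measurable_fun setT (t g : borel X -> borel X).
Proof. by apply: continuous_borel; exact: (ht.1 g).1. Qed.

Lemma jacobian_density g :
  is_density (pushforward mu (t g : borel X -> borel X)) mu (jacobian g).
Proof.
pose nu : {measure set (borel X) -> \bar R} :=
  @measure_function_pushforward__canonical__measure_function_Measure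
    _ _ _ _ _ mu _ (action_measurable g).
apply: (@RNderivP _ _ _ mu nu); last exact: tmu.
have [A TA mA] := sigma_finiteT mu.
exists (fun n => (t g^-1%g : borel X -> borel X) @^-1` A n).
  by rewrite -preimage_bigcup -TA preimage_setT.
move=> n; split.
  rewrite -[X in measurable X]setTI.
  by apply: action_measurable => //; exact: (mA n).1.
rewrite /nu/= /pushforward -comp_preimage.
rewrite (_ : _ \o _ = id) ?preimage_id; first exact: (mA n).2.
by apply/funext => x /=; rewrite homeomorphism_groupK.
Qed.

Lemma jacobian_change_of_variables g (h : X -> \bar R) :
  (forall x, 0 <= h x)%E -> measurable_fun setT (h : borel X -> \bar R) ->
  (\int[mu]_x ((jacobian g x)%:E * h (t g^-1%g x)) = \int[mu]_x h x)%E.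
Proof.
move=> h0 mh; pose h' : borel X -> \bar R := h \o t g^-1%g.
have mh' : measurable_fun setT h'.
  exact: (measurableT_comp mh (action_measurable _)).
pose nu : {measure set (borel X) -> \bar R} :=
  @measure_function_pushforward__canonical__measure_function_Measure
    _ _ _ _ _ mu _ (action_measurable g).
under eq_integral do rewrite muleC.
rewrite (@density_change_of_variables _ _ _ mu nu (jacobian g) h')//.
- rewrite (ge0_integral_pushforward (action_measurable g))//.
  rewrite preimage_setT; apply: eq_integral => x _.
  by rewrite /h'/= homeomorphism_groupK.
- by move=> x _; exact: h0.
- exact: jacobian_density.
- by move=> x; exact: h0.
Qed.

Lemma jacobian_ge0 g x : 0 <= jacobian g x.
Proof. by have [_ + _] := jacobian_density g. Qed.

Lemma strongly_measurable_real d (T : measurableType d) (rho : T -> R) :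
  measurable_fun setT rho ->
  strongly_measurable (fun x => (rho x)%:C : R[i]^o).
Proof.
move=> mrho.
have rE r s : rnorm (r%:C - s%:C : R[i]^o) = `|r - s|.
  rewrite -[LHS]/(complex.Re `|r%:C - s%:C : R[i]|) -rmorphB normc_def/=.
  by rewrite expr0n/= addr0 sqrtr_sqr.
have cC : continuous (fun r : R => r%:C : R[i]^o).
  move=> r; apply/cvg_rnormP => e e0; near=> s; rewrite rE.
  by near: s; exact: cvgr_dist_lt.
pose c n : R[i]^o := (if @choice.unpickle rat n is Some q then (ratr q : R)%:C else 0).
apply: (@strongly_measurable_separable _ _ R R[i]^o _ c) => [v e|x e e0].
  have : open [set r : R | rnorm (v - (r%:C : R[i]^o)) < e].
    apply: (@open_comp _ _ (fun r : R => rnorm (v - (r%:C : R[i]^o)))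
      [set r | r < e]); last exact: open_lt.
    move=> r _; apply: cvg_rnorm; apply/cvg_rnormP => d0 d00.
    have /cvg_rnormP/(_ _ d00) := cC r; apply: filterS => s rs.
    by rewrite opprB addrC addrA subrK -rnormN opprB.
  by move=> /open_measurable mo; have := mrho measurableT _ mo; rewrite setTI.
have : rho x < rho x + e by rewrite ltrDl.
move=> /rat_in_itvoo[q]; rewrite in_itv/= => /andP[q1 q2].
exists (choice.pickle q); rewrite /c choice.pickleK rE ger0_norm ?subr_ge0 ?(ltW q1)//.
by rewrite ltrBlDl.
Unshelve. all: by end_near. Qed.

Lemma shift_bochner_subproof (g : G) (f : bochner mu E) :
  (fun x => (jacobian g x)%:C *: f (t g^-1%g x)) \in
    @bochner_integrable _ _ _ mu E.
Proof.
have mf : strongly_measurable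
    (fun x : borel X => (jacobian g x)%:C *: f (t g^-1%g x)).
  apply: (@strongly_measurable_comp2 _ (borel X) R[i]^o E E
    (fun p => p.1 *: p.2) (fun x => (jacobian g x)%:C)
    (fun x => f (t g^-1%g x))).
  - exact: scale_continuous.
  - apply: (@strongly_measurable_real _ (borel X)).
    by have [] := jacobian_density g.
  - have [s ss sf] := bochner_strongly_measurable f.
    exists (fun n x => s n (t g^-1%g x)) => [n|x]; last exact: sf.
    split.
      apply: (sub_finite_set _ (simple_finite (ss n))).
      by move=> _ [x _ <-]; exists (t g^-1%g x).
    move=> v; have := simple_fiber v (ss n).
    by move=> /(action_measurable g^-1%g measurableT); rewrite setTI.
apply/asboolP; split => //.
under eq_integral do rewrite rnormZr ger0_norm ?jacobian_ge0// EFinM.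
rewrite (@jacobian_change_of_variables g (fun x => (rnorm (f x))%:E))//.
- exact: bochner_integral_lty.
- by move=> x; rewrite lee_fin rnorm_ge0.
- exact: bochner_measurable_rnorm.
Qed.

Definition shift_bochner (g : G) (f : bochner mu E) : bochner mu E :=
  Bochner (shift_bochner_subproof g f).

(* By homeomorphism_groupK, t g^-1 is the inverse of t g. The value on a class
   does not depend on the representative (shift_L1_classE). *)
Definition shift_L1 (g : G) (F : bochnerL1 mu E) : bochnerL1 mu E :=
  L1class (shift_bochner g (repr F)).

Lemma shift_L1_classE (g : G) (f : bochner mu E) :
  shift_L1 g (L1class f) = L1class (shift_bochner g f).
Proof.
apply/L1class_eq; have [N [mN N0 fN]] := repr_L1class f.
exists ((t g^-1%g : borel X -> borel X) @^-1` N); split.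
- rewrite -[X in measurable X]setTI.
  by apply: action_measurable.
- have /null_content_dominatesP := tmu g^-1%g; exact.
- move=> x /= h; apply: fN => /= fx; apply: h.
  by rewrite fx.
Qed.

Lemma shift_L1_isometry (g : G) F : rnorm (shift_L1 g F) = rnorm F.
Proof.
have [f ->] := L1classP F; rewrite shift_L1_classE; apply: EFin_inj.
rewrite !rnorm_L1class /=.
under eq_integral do rewrite rnormZr ger0_norm ?jacobian_ge0// EFinM.
rewrite (@jacobian_change_of_variables g (fun x => (rnorm (f x))%:E))//.
- by move=> x; rewrite lee_fin rnorm_ge0.
- exact: bochner_measurable_rnorm.
Qed.

Lemma shift_L1_subproof (g : G) :
  shift_L1 g \in @bounded_linear _ (bochnerL1 mu E) (bochnerL1 mu E).
Proof.
apply/asboolP; split=> [c F F'|].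
  have [[f ->] [f' ->]] := (L1classP F, L1classP F').
  rewrite -linearP !shift_L1_classE -linearP; congr L1class.
  apply/val_inj/funext => x.
  rewrite -[LHS]/((jacobian g x)%:C *: (c *: f (t g^-1%g x) + f' (t g^-1%g x))).
  by rewrite scalerDr !scalerA mulrC -scalerA.
by exists 1 => F; rewrite mul1r shift_L1_isometry.
Qed.

Definition shiftop (g : G) : bop (bochnerL1 mu E) (bochnerL1 mu E) :=
  Bop (shift_L1_subproof g).

End shift.

Section families.
Context {R : realType}.

Definition sphere_family (I : Type) (Y : normedModType R[i]) : set (I -> Y) :=
  [set f | forall i, rnorm (f i) = 1].

Definition ball_family (I : Type) (Y : normedModType R[i]) : set (I -> Y) :=
  [set f | forall i, rnorm (f i) <= 1].

End families.

Arguments sphere_family {R} I Y.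
Arguments ball_family {R} I Y.

(* Main.v *)
Require Import Defs.
From HB Require Import structures.
From mathcomp Require Import all_boot all_order all_algebra finmap.
From mathcomp Require Import complex.
From mathcomp Require Import all_classical all_reals all_analysis.
From mathcomp Require Import measurable_realfun.
From mathcomp Require Import lra ring.

Set Implicit Arguments.
Unset Strict Implicit.
Unset Printing Implicit Defensive.

Import Order.TTheory GRing.Theory Num.Theory.
Import numFieldNormedType.Exports.

Local Open Scope classical_set_scope.
Local Open Scope ring_scope.
Local Open Scope complex_scope.

(* For operators A_g on E, the supremum of the norm of the sum of the A_g^* f_g,
   over the unit spheres as well as over the unit balls of E^*, is the supremum
   of the sum of the |A_g v| over |v| <= 1: functionals norming the A_g v exist
   by the Hahn-Banach theorem. So it suffices to show that the operator norm is
   the supremum over x and |v| <= 1 of the sum of the |a_g(t_g(x)) v|. The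
   change of variables y = t_g^{-1}(x) in each summand bounds the operator norm
   by this supremum. Conversely, given x and v, topological freeness yields an
   open set V, on which the coefficients are almost those at x, with the t_g(V)
   pairwise disjoint. On v 1_S, for S in V of finite positive measure, the
   summands have disjoint supports, so their norms add up. *)

(** * Norming functionals by the Hahn-Banach theorem *)

Section hahn_banach.
Context {R : realType}.

Section sublinear.
Context {V : lmodType R[i]}.
Implicit Types (q : V -> R) (u v w : V).

(** Scalars are real although the space is complex. The inequality for all [c > 0] amounts to
    equality, by applying it to [c^-1] as well. *)
Definition sublinear q :=
  (forall v w, q (v + w) <= q v + q w) /\
  (forall (c : R) v, 0 < c -> q (c%:C *: v) <= c * q v).

Lemma sublinear0 q : sublinear q -> q 0 = 0.
Proof.
move=> [qD qZ]; have := qD 0 0; have := qZ 2^-1 0.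
rewrite addr0 scaler0 invr_gt0 ltr0n => /(_ isT) q1 q2.
by lra.
Qed.

Lemma sublinearN q v : sublinear q -> - q (- v) <= q v.
Proof.
move=> qs; rewrite -subr_ge0 opprK -(sublinear0 qs) -[X in q X](subrr v).
exact: qs.1.
Qed.

(* The largest sublinear minorant of q whose value at - v is - q v. *)
Definition shave q v : V -> R := fun u =>
  inf [set q (u + (s : R)%:C *: v) - s * q v | s in [set s | 0 <= s]].

Lemma shave_le q v u s : sublinear q -> 0 <= s ->
  shave q v u <= q (u + s%:C *: v) - s * q v.
Proof.
move=> qs s0; apply: ge_inf; last by exists s.
(* A lower bound makes [inf] a true infimum: q(rv) <= q(u + rv) + q(-u) by subadditivity, and r q(v)
   <= q(rv) for r > 0. *)
exists (- q (- u)) => _ [r /= r0 <-].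
have [->|rN0] := eqVneq r 0.
  by rewrite scale0r addr0 mul0r subr0 sublinearN.
have {rN0}r0 : 0 < r by rewrite lt_def rN0.
have := qs.1 (u + r%:C *: v) (- u); rewrite addrAC subrr add0r.
have := qs.2 r^-1 (r%:C *: v); rewrite invr_gt0 => /(_ r0).
rewrite scalerA -rmorphM mulVf ?gt_eqF// scale1r mulrC ler_pdivlMr// mulrC.
by lra.
Qed.

Lemma le_shave q v u (m : R) :
  (forall s, 0 <= s -> m <= q (u + s%:C *: v) - s * q v) -> m <= shave q v u.
Proof.
move=> ms; apply: lb_le_inf => [|_ [s /= s0 <-]]; last exact: ms.
by exists (q (u + 0%:C *: v) - 0 * q v), 0 => /=.
Qed.

(** If s is a competitor for u and r one for w, then s + r is one for u + w; likewise c s is one for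
    c u. *)
Lemma shave_sublinear q v : sublinear q -> sublinear (shave q v).
Proof.
move=> qs; split=> [u w|c u c0].
  rewrite -lerBlDr; apply: le_shave => s s0.
  rewrite lerBlDr -lerBlDl; apply: le_shave => r r0.
  have := @shave_le _ v (u + w) (s + r) qs; rewrite addr_ge0// => /(_ isT).
  have := qs.1 (u + s%:C *: v) (w + r%:C *: v).
  by rewrite rmorphD scalerDl addrACA; lra.
rewrite mulrC -ler_pdivrMr//; apply: le_shave => s s0.
rewrite ler_pdivrMr//.
have := @shave_le _ v (c%:C *: u) (c * s) qs.
rewrite mulr_ge0 ?(ltW c0)// => /(_ isT); have := qs.2 c (u + s%:C *: v) c0.
have -> : c%:C *: (u + s%:C *: v) = c%:C *: u + (c * s)%:C *: v.
  by rewrite scalerDr scalerA -rmorphM.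
move: (q _) (q _) (shave _ _ _) => x y z.
by lra.
Qed.

Lemma shave_le_id q v u : sublinear q -> shave q v u <= q u.
Proof.
by move=> /(@shave_le q v u 0)/(_ (lexx _)); rewrite scale0r addr0 mul0r subr0.
Qed.

(* Hahn-Banach without partial functionals: a minimal sublinear functional is
   additive, since it coincides with all its minorants shave q w
   (minimal_sublinearD). *)
Lemma minimal_sublinear (p : V -> R) : sublinear p ->
  exists q, [/\ sublinear q, (forall v, q v <= p v) &
    forall r, sublinear r -> (forall v, r v <= q v) -> r = q].
Proof.
move=> ps; pose T := {q : V -> R | sublinear q /\ forall v, q v <= p v}.
(* The order is reversed, so that a maximal element in Zorn's lemma is a minimal functional. *)
pose rel (q r : T) := `[< forall v, sval r v <= sval q v >].
have [|||A tA|q qmin] := @Zorn T rel.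
- by move=> q; apply/asboolP.
- move=> q r s /asboolP rq /asboolP qs; apply/asboolP => v.
  exact: le_trans (qs v) (rq v).
- move=> q r /asboolP rq /asboolP qr.
  apply: eq_sig_hprop => [*|]; first exact: Prop_irrelevance.
  by apply/funext => v; apply/eqP; rewrite eq_le qr rq.
- have [->|/set0P[q0 Aq0]] := eqVneq A set0; first
    by exists (exist _ p (conj ps (fun=> lexx _))).
  (* A nonempty chain is bounded by its pointwise infimum, which is finite since every member r
     satisfies -p(-v) <= r(v). *)
  pose Q v := inf [set sval q v | q in A].
  have Qle (q : T) v : A q -> Q v <= sval q v.
    move=> Aq; apply: ge_inf; last by exists q.
    exists (- p (- v)) => _ [r Ar <-]; have [rs rp] := svalP r.
    by rewrite (le_trans _ (sublinearN _ rs))// lerN2.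
  have Qge m v : (forall q : T, A q -> m <= sval q v) -> m <= Q v.
    move=> mq; apply: lb_le_inf; first by exists (sval q0 v), q0.
    by move=> _ [q Aq <-]; exact: mq.
  have Qs : sublinear Q.
    split=> [v w|c v c0].
      rewrite -lerBlDr; apply: (Qge) => q Aq; rewrite lerBlDr -lerBlDl.
      apply: (Qge) => r Ar; rewrite lerBlDl.
      (* The smaller of the two members serves for both arguments. *)
      have [/asboolP rq|/asboolP qr] := tA _ _ Aq Ar.
        rewrite (le_trans (Qle _ _ Ar))// (le_trans ((svalP r).1.1 _ _))//.
        by rewrite lerD.
      rewrite (le_trans (Qle _ _ Aq))// (le_trans ((svalP q).1.1 _ _))//.
      by rewrite lerD.
    rewrite mulrC -ler_pdivrMr//; apply: (Qge) => q Aq; rewrite ler_pdivrMr//.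
    by rewrite (le_trans (Qle _ _ Aq))// mulrC; exact: (svalP q).1.2.
  have Qp v : Q v <= p v by rewrite (le_trans (Qle _ v Aq0))//; exact: (svalP q0).2.
  by exists (exist _ Q (conj Qs Qp)) => q Aq; apply/asboolP => v; exact: Qle.
have [qs qp] := svalP q; exists (sval q); split=> // r rs rq.
have rp v : r v <= p v by exact: le_trans (rq v) (qp v).
by have /(congr1 sval) := qmin (exist _ r (conj rs rp)) (asboolT rq).
Qed.

Lemma minimal_sublinearD q : sublinear q ->
  (forall r, sublinear r -> (forall v, r v <= q v) -> r = q) ->
  {morph q : v w / v + w}.
Proof.
move=> qs qmin v w; apply/eqP; rewrite eq_le qs.1 /=.
(* By minimality [shave q w] is [q]; the competitor s = 1 in its infimum then gives q(v) <= q(v + w)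
   - q(w). *)
have qE := qmin _ (shave_sublinear w qs) (fun u => shave_le_id w u qs).
have := shave_le w v qs ler01.
by rewrite qE scale1r mul1r lerBrDr.
Qed.

End sublinear.

(* Apply a minimal sublinear functional below shave rnorm v, which takes the
   value - rnorm v at - v. *)
Lemma real_norming_functional (V : normedModType R[i]) (v : V) :
  exists q : V -> R, [/\ {morph q : u w / u + w},
    (forall (c : R) u, q (c%:C *: u) = c * q u),
    (forall u, q u <= rnorm u) & q v = rnorm v].
Proof.
have ns : sublinear (@rnorm R V).
  split=> [u w|c u c0]; first exact: rnormD.
  by rewrite rnormZr gtr0_norm.
have [q [qs qle qmin]] := minimal_sublinear (shave_sublinear v ns).
have qD := minimal_sublinearD qs qmin.
have qN u : q (- u) = - q u.
  by apply/eqP; rewrite -addr_eq0 -qD addNr sublinear0.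
have qZ0 (c : R) u : 0 < c -> q (c%:C *: u) = c * q u.
  move=> c0; apply/eqP; rewrite eq_le qs.2//=.
  by have := qs.2 c (- u) c0; rewrite scalerN !qN mulrN lerN2.
exists q; split=> // [c u|u|].
- have [c0|c0|<-] := ltgtP 0 c; first exact: qZ0.
  + rewrite -[c in LHS]opprK rmorphN scaleNr qN qZ0 ?oppr_gt0//.
    by rewrite mulNr opprK.
  + by rewrite scale0r mul0r sublinear0.
- exact: le_trans (qle u) (shave_le_id v u ns).
- apply/eqP; rewrite eq_le (le_trans (qle v) (shave_le_id v v ns))/=.
  rewrite -lerN2 -qN (le_trans (qle _))//.
  rewrite (le_trans (shave_le v (- v) ns ler01))//.
  by rewrite scale1r addNr rnorm0 mul1r sub0r.
Qed.

Lemma rnorm_scalar (z : R[i]) : (rnorm (z : R[i]^o))%:C = `|z|.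
Proof. by rewrite -rnormE. Qed.

(** The real-linear functional q norming v is the real part of the complex-linear functional phi(u)
    = q(u) - i q(iu). Since v is nonzero, phi(v) = |v| forces the norm of phi to be at least 1. *)
Lemma norming_functional (V : normedModType R[i]) (v : V) : v != 0 ->
  exists2 phi : dual V, rnorm phi = 1 & phi v = (rnorm v)%:C.
Proof.
move=> v0; have [q [qD qZ qle qv]] := real_norming_functional v.
pose phi u : R[i]^o := q u +i* - q ('i *: u).
have phiZ c u : phi (c *: u) = c * phi u.
  case: c => a b; have -> : a +i* b = a%:C + 'i * b%:C.
    by apply/eqP; rewrite eq_complex/=; apply/andP; split; apply/eqP; ring.
  rewrite [LHS]/phi.
  have -> : (a%:C + 'i * b%:C) *: u = a%:C *: u + b%:C *: ('i *: u).
    by rewrite scalerDl mulrC scalerA.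
  have -> : 'i *: (a%:C *: u + b%:C *: ('i *: u)) = a%:C *: ('i *: u) + (- b)%:C *: u.
    rewrite scalerDr !scalerA mulrC [_ * b%:C]mulrC -mulrA -expr2 sqr_i mulrN1.
    by rewrite -rmorphN.
  rewrite !qD !qZ; apply/eqP; rewrite eq_complex/=.
  by apply/andP; split; apply/eqP; ring.
have phiD u w : phi (u + w) = phi u + phi w.
  rewrite /phi scalerDr !qD; apply/eqP; rewrite eq_complex/= eqxx/=.
  by rewrite opprD.
have philin : linear phi by move=> c u w; rewrite phiD phiZ.
have phile u : rnorm (phi u) <= rnorm u.
  have [->|pu0] := eqVneq (phi u) 0; first by rewrite rnorm0 rnorm_ge0.
  (* The unit scalar [c] rotates phi(u) to |phi(u)|, which is thus the real part q(cu) of phi(cu),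
     at most |cu| = |u|. *)
  pose c : R[i] := `|phi u| / phi u.
  have cN : rnorm (c : R[i]^o) = 1.
    apply: complexI; rewrite rnorm_scalar /c normf_div normr_id.
    by rewrite divff ?normr_eq0.
  rewrite -[leRHS]mul1r -cN -rnormZ (le_trans _ (qle _))//.
  by rewrite -[q _]/(complex.Re (phi (c *: u))) phiZ /c divfK// -rnorm_scalar.
have phiB : phi \in @bounded_linear R V R[i]^o.
  by apply/asboolP; split=> //; exists 1 => u; rewrite mul1r.
have phiv : phi v = (rnorm v)%:C.
  (* The modulus of phi(v) is at most its real part q(v), so its imaginary part vanishes. *)
  have qphi : rnorm (phi v) <= q v by rewrite qv.
  have q0 : 0 <= q v by rewrite qv rnorm_ge0.
  apply/eqP; rewrite eq_complex/= qv eqxx/= oppr_eq0 -sqrf_eq0.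
  have qphi2 : rnorm (phi v) ^+ 2 <= q v ^+ 2.
    by rewrite lerXn2r ?nnegrE ?rnorm_ge0.
  rewrite eq_le sqr_ge0 andbT -(lerD2l (q v ^+ 2)) addr0.
  move: qphi2; rewrite /rnorm normc_def/= sqr_sqrtr ?addr_ge0 ?sqr_ge0//.
  by rewrite sqrrN.
exists (Bop phiB) => //.
apply/eqP; rewrite eq_le; apply/andP; split.
  by apply: opnorm_le => u u1; exact: le_trans (phile u) u1.
have vgt0 : 0 < rnorm v by rewrite lt_def rnorm_ge0 andbT; apply: contra_neq v0; exact: rnorm_eq0.
rewrite -(ler_pM2r vgt0) mul1r.
have := le_opnorm (Bop phiB) v; rewrite /= phiv; apply: le_trans.
by rewrite -lecR rnorm_scalar ger0_norm// lecR ltW.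
Qed.
End hahn_banach.

(** * Norms of finite sums and of sums of adjoints *)

Lemma rnorm_sum {R : realType} {V : normedModType R[i]} (I : Type) (r : seq I)
    (P : pred I) (f : I -> V) :
  rnorm (\sum_(i <- r | P i) f i) <= \sum_(i <- r | P i) rnorm (f i).
Proof.
elim/big_rec2: _ => [|i x y _ xy]; first by rewrite rnorm0.
by rewrite (le_trans (rnormD _ _))// lerD2l.
Qed.

Section adjoint_families.
Context {R : realType} {V W : normedModType R[i]} {I : finType}.
Variable A : I -> bop V W.

Lemma rnorm_sum_adjoint_le (f : I -> dual W) (M : R) : ball_family I (dual W) f ->
    (forall v, rnorm v <= 1 -> \sum_i rnorm (A i v) <= M) ->
  rnorm (\sum_i adjoint (A i) (f i)) <= M.
Proof.
move=> f1 AM; apply: opnorm_le => v v1; rewrite bop_sumE.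
rewrite (le_trans (rnorm_sum _ _ _))// (le_trans _ (AM v v1))//.
apply: ler_sum => i _ /=; rewrite (le_trans (le_opnorm _ _))//.
by rewrite ler_piMl ?rnorm_ge0//; exact: f1.
Qed.

(** If each f_i norms A_i v, the sum of adjoints evaluated at v is a sum of nonnegative reals,
    without cancellation. *)
Lemma sum_rnorm_le_adjoint (v : V) : (exists w : W, w != 0) -> rnorm v <= 1 ->
  exists2 f : I -> dual W, sphere_family I (dual W) f &
    \sum_i rnorm (A i v) <= rnorm (\sum_i adjoint (A i) (f i)).
Proof.
move=> [w w0] v1.
have /choice[f fP] : forall i, exists phi : dual W,
    rnorm phi = 1 /\ phi (A i v) = (rnorm (A i v))%:C.
  move=> i; have [->|Av0] := eqVneq (A i v) 0.
    (* Where A_i v = 0, any functional of norm 1 will do; one exists because [W] is nonzero. *)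
    have [phi phi1 _] := norming_functional w0.
    by exists phi; rewrite linear0 rnorm0.
  by have [phi phi1 phiv] := norming_functional Av0; exists phi.
exists f; first by move=> i; exact: (fP i).1.
apply: (le_trans _ (le_opnorm1 (\sum_i adjoint (A i) (f i)) v1)).
rewrite bop_sumE /=; under [in leRHS]eq_bigr do rewrite (fP _).2.
rewrite -rmorph_sum -lecR rnorm_scalar ger0_norm// lecR.
by apply: sumr_ge0 => i _; exact: rnorm_ge0.
Qed.

End adjoint_families.

(** At most one summand is nonzero. This is applied pointwise to functions with disjoint
    supports. *)
Lemma rnorm_sum_disjoint {R : realType} {V : normedModType R[i]} (I : finType)
    (f : I -> V) : (forall i j, i != j -> f i = 0 \/ f j = 0) ->
  rnorm (\sum_i f i) = \sum_i rnorm (f i).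
Proof.
move=> f0; have [[i fi]|/forallNP f00] := pselect (exists i, f i <> 0).
  have fj j : j != i -> f j = 0 by move=> /f0[].
  rewrite (bigD1 i)//= [in RHS](bigD1 i)//= !big1 ?addr0// => j ji.
  by rewrite fj// rnorm0.
have fE i : f i = 0 by exact: contrapT.
by rewrite !big1 ?rnorm0// => i _; rewrite fE// rnorm0.
Qed.

Lemma bochner_sumE d (T : measurableType d) (R : realType)
    (mu : {measure set T -> \bar R}) (E : normedModType R[i]) (I : Type)
    (r : seq I) (P : pred I) (f : I -> bochner mu E) x :
  (\sum_(i <- r | P i) f i) x = \sum_(i <- r | P i) f i x.
Proof. by elim/big_rec2: _ => //= i y z _ <-. Qed.

(** * Open sets with disjoint images under a topologically free action *)

Section displacement.
Context {X : ptopologicalType} {G : groupType}.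
Variables (t : G -> X -> X).
Hypothesis X_hausdorff : hausdorff_space X.
Hypothesis t_group : homeomorphism_group t.
Hypothesis t_free : topologically_free t.

(** If t_g and t_h agreed on U, then h^-1 g would fix U pointwise, against topological freeness. So
    they differ at a point of U; disjoint neighbourhoods of its two images are pulled back. *)
Lemma topologically_free_separate (g h : G) (U : set X) : g != h -> open U ->
    U !=set0 ->
  exists V : set X, [/\ open V, V !=set0, V `<=` U &
    forall x y, V x -> V y -> t g x <> t h y].
Proof.
move=> gh oU U0.
have [x [Ux tx]] : exists x, U x /\ t g x <> t h x.
  apply: contrapT => /forallNP tE.
  have : U `<=` [set x | t (h^-1 * g)%g x = x]^°.
    rewrite -open_subsetE// => x Ux /=; rewrite t_group.2 /=.
    have -> : t g x = t h x by apply: contrapT => txx; exact: tE (conj Ux txx).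
    exact: homeomorphism_groupK.
  rewrite t_free; first by move: U0 => [x Ux] /(_ x Ux).
  by apply: contra_neq gh => hg; rewrite -[h]mulg1 -hg mulgA mulgV mul1g.
have := X_hausdorff; rewrite open_hausdorff => /(_ (t g x) (t h x)).
move=> /(_ (introN eqP tx))[[A B]/= [/set_mem Ax /set_mem Bx] [oA oB /eqP AB]].
exists (U `&` (t g @^-1` A `&` t h @^-1` B)); split.
- apply: openI => //; apply: openI.
  + by move/continuousP : (t_group.1 g).1; exact.
  + by move/continuousP : (t_group.1 h).1; exact.
- by exists x.
- exact: subIsetl.
- move=> y z [_ [Ay _]] [_ [_ Bz]] yz.
  have : (A `&` B) (t g y) by split; rewrite // yz.
  by rewrite AB.
Qed.

(** The finitely many ordered pairs are separated one after the other: disjointness, once reached,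
    survives shrinking the set. *)
Lemma topologically_free_displace (I : finType) (u : I -> G) (U : set X) :
    injective u -> open U -> U !=set0 ->
  exists V : set X, [/\ open V, V !=set0, V `<=` U &
    forall i j, i != j -> forall x y, V x -> V y -> t (u i) x <> t (u j) y].
Proof.
move=> u_inj oU U0.
suff [V [oV V0 VU tV]] : exists V : set X, [/\ open V, V !=set0, V `<=` U &
    forall p, p \in enum [pred p : I * I | p.1 != p.2] ->
      forall x y, V x -> V y -> t (u p.1) x <> t (u p.2) y].
  exists V; split=> // i j ij; apply: (tV (i, j)).
  by rewrite mem_enum inE.
have : forall p, p \in enum [pred p : I * I | p.1 != p.2] -> p.1 != p.2.
  by move=> p; rewrite mem_enum inE.
elim: (enum _) => [_|p s IH ps]; first by exists U; split.
have [|V [oV V0 VU tV]] := IH; first by move=> q qs; apply: ps; rewrite inE qs orbT.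
have [|W [oW W0 WV tW]] := @topologically_free_separate (u p.1) (u p.2) V _ oV V0.
  by rewrite (inj_eq u_inj) ps ?mem_head.
exists W; split=> //; first exact: subset_trans WV VU.
move=> q; rewrite inE => /orP[/eqP->//|qs] x y /WV Vx /WV Vy.
exact: tV.
Qed.

End displacement.

(** * Sets of finite positive measure and test functions *)

Lemma sigma_finite_subset d (T : measurableType d) (R : realType)
    (mu : {measure set T -> \bar R}) (A : set T) : sigma_finite setT mu ->
    measurable A -> (0 < mu A)%E ->
  exists B, [/\ measurable B, B `<=` A, (0 < mu B)%E & (mu B < +oo)%E].
Proof.
move=> [S TS mS] mA A0; apply: contrapT => /forallNP noB.
have mAS n : measurable (A `&` S n) by apply: measurableI => //; exact: (mS n).1.
(* If all slices of [A] by the sets [S n] of finite measure were null, so would be their union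
   [A]. *)
have : mu.-negligible (\bigcup_n (A `&` S n)).
  apply: negligible_bigcup => n; apply/negligibleP => //.
  apply/eqP; rewrite -measure_le0 leNgt; apply/negP => ASn.
  apply: (noB (A `&` S n)); split=> //.
  by rewrite (le_lt_trans _ (mS n).2)// le_measure ?inE//; exact: (mS n).1.
rewrite -setI_bigcupr -TS setIT => /negligibleP => /(_ mA) A00.
by rewrite A00 ltxx in A0.
Qed.

Lemma bochner_indic d (T : measurableType d) (R : realType)
    (mu : {measure set T -> \bar R}) (E : normedModType R[i]) (S : set T)
    (v : E) : measurable S -> (mu S < +oo)%E ->
  exists2 f : bochner mu E, (forall x, f x = if `[< S x >] then v else 0) &
    (rnorm (L1class f))%:E = ((rnorm v)%:E * mu S)%E.
Proof.
move=> mS Soo; pose f x := if `[< S x >] then v else 0.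
have fE x : (rnorm (f x))%:E = ((rnorm v)%:E * (\1_S x)%:E)%E.
  rewrite /f indicE -EFinM; case: asboolP => Sx.
    by rewrite mem_set// mulr1.
  by rewrite memNset// rnorm0 mulr0.
have fint : (\int[mu]_x (rnorm (f x))%:E = (rnorm v)%:E * mu S)%E.
  under eq_integral do rewrite fE.
  rewrite ge0_integralZl_EFin ?rnorm_ge0//; first by rewrite integral_indic// setIT.
  by apply/measurable_EFinP; exact: measurable_indic.
suff fi : f \in @bochner_integrable _ _ _ mu E.
  by exists (Bochner fi) => //; rewrite rnorm_L1class.
apply/asboolP; split; last by rewrite fint lte_mul_pinfty// lee_fin rnorm_ge0.
(* The function is itself simple, as it factors through the truth value of membership in [S]; a
   constant sequence suffices. *)
exists (fun=> f) => [_|x]; last exact: cvg_cst.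
apply: (simple_comp (fun c : bool => if c then v else 0)).
split=> [|c]; first exact: finite_finset.
have SE : (fun x => `[< S x >]) @^-1` [set true] = S.
  by apply/seteqP; split=> x /= /asboolP.
case: c; rewrite ?SE// -[false]/(~~ true) => {SE}.
rewrite (_ : _ @^-1` _ = ~` S); first exact: measurableC.
apply/seteqP; split=> x /=; first by move=> /negbT/asboolP.
by move=> Sx; apply/negbTE/asboolP.
Qed.

(** * The two bounds for the norm of a sum of weighted shifts *)

Section weighted_shifts.
Context {R : realType} {X : ptopologicalType} {G : groupType}.
Variables (mu : {sigma_finite_measure set (borel X) -> \bar R}).
Hypothesis mu_supp : msupport mu = [set: X].
Variables (t : G -> X -> X) (t_group : homeomorphism_group t).
Hypothesis t_mu : preserves_class mu t.
Variable E : normedModType R[i].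

Lemma measurable_rnorm_mul (a : Cb X (bop E E)) g (f : bochner mu E) :
  measurable_fun setT (fun x : borel X => (rnorm (a (t g x) (f x)))%:E).
Proof.
apply: measurable_EFin_rnorm.
apply: (@strongly_measurable_comp2 _ (borel X) (bop E E) E E
  (fun p => p.1 p.2) (a \o t g) f).
- exact: bop_eval_continuous.
- apply: (strongly_measurable_continuous mu_supp) => x.
  apply: continuous_comp; last exact: Cb_continuous.
  exact: (t_group.1 g).1.
- exact: bochner_strongly_measurable.
Qed.

(** The nonnegative Jacobian comes out of the norm and is absorbed by the change of variables, which
    replaces x by t_g(x) in the coefficient. *)
Lemma integral_weighted_shift (a : Cb X (bop E E)) g (f : bochner mu E) :
  (\int[mu]_x (rnorm (mul_bochner mu_supp a (shift_bochner t_group t_mu g f) x))%:E =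
   \int[mu]_x (rnorm (a (t g x) (f x)))%:E)%E.
Proof.
rewrite -[RHS](jacobian_change_of_variables t_group t_mu g); last 2 first.
- by move=> x; rewrite lee_fin rnorm_ge0.
- exact: measurable_rnorm_mul.
apply: eq_integral => x _ /=.
rewrite homeomorphism_groupVK// linearZ rnormZr.
by rewrite ger0_norm ?EFinM//; exact: jacobian_ge0.
Qed.

Variables (I : finType) (u : I -> G) (a : I -> Cb X (bop E E)).

(** The finite subset of the group is encoded as a family [u] over a finite type; injectivity of [u]
    is assumed only for the lower bound. *)
Definition sum_weighted_shifts : bop (bochnerL1 mu E) (bochnerL1 mu E) :=
  \sum_i comp_bop (mulop mu_supp (a i)) (shiftop t_group t_mu E (u i)).

Let b (f : bochner mu E) i : bochner mu E :=
  mul_bochner mu_supp (a i) (shift_bochner t_group t_mu (u i) f).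

Lemma sum_weighted_shifts_classE (f : bochner mu E) :
  sum_weighted_shifts (L1class f) = \sum_i L1class (b f i).
Proof.
rewrite bop_sumE; apply: eq_bigr => i _.
by rewrite -[LHS]/(mul_L1 mu_supp (a i) (shift_L1 t_group t_mu (u i) (L1class f)))
  shift_L1_classE mul_L1_classE.
Qed.

Lemma sum_integral_weighted_shift (f : bochner mu E) :
  (\sum_i \int[mu]_x (rnorm (b f i x))%:E =
   \int[mu]_x (\sum_i rnorm (a i (t (u i) x) (f x)))%:E)%E.
Proof.
under [RHS]eq_integral do rewrite -sumEFin.
rewrite ge0_integral_sum//; last 2 first.
- by move=> i; exact: measurable_rnorm_mul.
- by move=> i x _; rewrite lee_fin rnorm_ge0.
by apply: eq_bigr => i _; exact: integral_weighted_shift.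
Qed.

(** After the triangle inequality in L^1, the changes of variables bring all summands to the same
    f(x), where the pointwise hypothesis applies. *)
Lemma opnorm_sum_weighted_shifts_le (k : R) : 0 <= k ->
    (forall x v, \sum_i rnorm (a i (t (u i) x) v) <= k * rnorm v) ->
  opnorm sum_weighted_shifts <= k.
Proof.
move=> k0 ak; apply: opnorm_le => Fc; have [f ->] := L1classP Fc => f1.
rewrite sum_weighted_shifts_classE (le_trans (rnorm_sum _ _ _))//.
rewrite -lee_fin -sumEFin; under eq_bigr do rewrite rnorm_L1class.
rewrite sum_integral_weighted_shift.
rewrite (@le_trans _ _ (\int[mu]_x (k%:E * (rnorm (f x))%:E))%E)//.
  apply: ge0_le_integral => //.
  - by move=> x _; rewrite lee_fin sumr_ge0// => i _; exact: rnorm_ge0.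
  - under eq_fun do rewrite -sumEFin.
    by apply: emeasurable_sum => i; exact: measurable_rnorm_mul.
  - by apply: measurable_funeM; exact: bochner_measurable_rnorm.
  - by move=> x _; rewrite -EFinM lee_fin.
rewrite ge0_integralZl_EFin//; last 2 first.
- by move=> x _; rewrite lee_fin rnorm_ge0.
- exact: bochner_measurable_rnorm.
by rewrite -rnorm_L1class -EFinM lee_fin ler_piMr.
Qed.

Hypothesis X_hausdorff : hausdorff_space X.
Hypothesis t_free : topologically_free t.
Hypothesis u_inj : injective u.

(* Test on f = v 1_S, where S has positive finite measure and is so small that
   the coefficients are almost constant along S and the sets t (u i) S, which
   carry the summands of the image of f, are pairwise disjoint. *)
Lemma le_opnorm_sum_weighted_shifts x0 v : rnorm v <= 1 ->
  \sum_i rnorm (a i (t (u i) x0) v) <= opnorm sum_weighted_shifts.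
Proof.
move=> v1; pose h x := \sum_i rnorm (a i (t (u i) x) v).
rewrite -/(h x0); apply/ler_addgt0Pr => e e0; rewrite -lerBlDr.
(* In the remaining case [h x0 - e] is positive and can be taken out of the integral of an indicator
   below. *)
have [h0|h0] := leP (h x0 - e) 0; first by rewrite (le_trans h0)// opnorm_ge0.
have ch : continuous h.
  apply: continuous_big => [|i _ x]; first exact: add_continuous.
  apply: cvg_rnorm.
  have ca : a i (t (u i) y) @[y --> x] --> a i (t (u i) x).
    apply: (continuous_comp ((t_group.1 (u i)).1 x)); exact: Cb_continuous.
  have cv : v @[_ --> x] --> v by exact: cvg_cst.
  apply: (@cvg_comp _ _ _ (fun y => (a i (t (u i) y), v)) (fun p => p.1 p.2)).
    exact: cvg_pair ca cv.
  exact: (@bop_eval_continuous _ E E (a i (t (u i) x), v)).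
have [||V [oV [x1 Vx1] Vh tV]] :=
    @topologically_free_displace _ _ t X_hausdorff t_group t_free I u
      (h @^-1` [set r | h x0 - e < r]) u_inj.
- by apply: open_comp => [x _|]; [exact: ch|exact: open_gt].
- by exists x0; rewrite /= ltrBlDr ltrDl.
have [||S [mS SV S0 Soo]] := @sigma_finite_subset _ (borel X) R mu V (sigma_finiteT mu).
- exact: open_borel.
- have : msupport mu x1 by rewrite mu_supp.
  exact.
have [f fE fN] := @bochner_indic _ (borel X) R mu E S v mS Soo.
have [m SfE] : exists m : R, mu S = m%:E.
  by exists (fine (mu S)); rewrite fineK// ge0_fin_numE.
have m0 : 0 < m by rewrite -lte_fin -SfE.
(* After multiplication by m = mu(S), the norm of the image of f can be inserted, because |f| = |v|
   m <= m. *)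
rewrite -(ler_pM2r m0).
apply: (@le_trans _ _ (opnorm sum_weighted_shifts * rnorm (L1class f))); last first.
  rewrite ler_wpM2l ?opnorm_ge0// -lee_fin (_ : (rnorm (L1class f))%:E = (rnorm v * m)%:E).
    by rewrite lee_fin ler_piMl// ltW.
  by rewrite EFinM -SfE.
apply: le_trans (le_opnorm _ _).
rewrite sum_weighted_shifts_classE -linear_sum -lee_fin rnorm_L1class.
(* For each x at most one of the points t_{u i}^{-1}(x) lies in [S], so at most one summand is
   nonzero at x. *)
under eq_integral => x _.
  rewrite bochner_sumE rnorm_sum_disjoint -?sumEFin; last first.
    move=> i j ij; rewrite /b /= !fE.
    case: asboolP => [Si|_]; last by left; rewrite !linear0.
    case: asboolP => [Sj|_]; last by right; rewrite !linear0.
    have := tV i j ij _ _ (SV _ Si) (SV _ Sj).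
    by rewrite !homeomorphism_groupVK.
  over.
rewrite ge0_integral_sum//; last 2 first.
- by move=> i; exact: bochner_measurable_rnorm.
- by move=> i x _; rewrite lee_fin rnorm_ge0.
rewrite sum_integral_weighted_shift.
(* The left side becomes the integral of (h(x0) - e) 1_S, while the integrand on the right is [h] on
   [S], where it exceeds h(x0) - e. *)
rewrite EFinM -SfE -[X in mu X]setIT -integral_indic//.
rewrite -ge0_integralZl_EFin ?(ltW h0)//; last first.
  by apply/measurable_EFinP; exact: measurable_indic.
apply: ge0_le_integral => //.
- by move=> x _; rewrite -EFinM lee_fin mulr_ge0 ?(ltW h0).
- by apply: measurable_funeM; apply/measurable_EFinP; exact: measurable_indic.
- under eq_fun do rewrite -sumEFin.
  by apply: emeasurable_sum => i; exact: measurable_rnorm_mul.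
- move=> x _; rewrite -EFinM lee_fin indicE.
  have [Sx|Sx] := pselect (S x); last first.
    by rewrite memNset// mulr0 sumr_ge0// => i _; exact: rnorm_ge0.
  rewrite mem_set// mulr1; have /SV/Vh/= /ltW := Sx.
  by rewrite /h fE asboolT.
Qed.

End weighted_shifts.

(** * The norm formula over spheres and balls of the dual *)

Theorem mainTheorem6 (R : realType) (X : ptopologicalType)
    (X_hausdorff : hausdorff_space X) (X_creg : completely_regular_space X)
    (mu : {sigma_finite_measure set (borel X) -> \bar R})
    (mu_supp : msupport mu = [set: X])
    (E : completeNormedModType R[i]) (E_neq0 : exists v : E, v != 0)
    (G : groupType) (t : G -> X -> X)
    (t_group : homeomorphism_group t) (t_mu : preserves_class mu t)
    (t_free : topologically_free t)
    (F : {fset G}) (F_neq0 : F != fset0) (a : F -> Cb X (bop E E)) :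
  (rnorm (\sum_(g : F)
      comp_bop (mulop mu_supp (a g)) (shiftop t_group t_mu E (val g))))%:E =
    ereal_sup [set
      ereal_sup [set
        (rnorm (\sum_(g : F) adjoint (a g (t (val g) x)) (f g)))%:E
        | f in sphere_family F (dual E)]
      | x in [set: X]]
  /\
  ereal_sup [set
      ereal_sup [set
        (rnorm (\sum_(g : F) adjoint (a g (t (val g) x)) (f g)))%:E
        | f in sphere_family F (dual E)]
      | x in [set: X]] =
    ereal_sup [set
      ereal_sup [set
        (rnorm (\sum_(g : F) adjoint (a g (t (val g) x)) (f g)))%:E
        | f in ball_family F (dual E)]
      | x in [set: X]].
Proof.
pose B := sum_weighted_shifts mu_supp t_group t_mu (fun g : F => val g) a.
rewrite -/(@sum_weighted_shifts R X G mu mu_supp t t_group t_mu E F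
  (fun g : F => val g) a) -/B.
(* With [S] the supremum over spheres and [T] the one over balls, both equalities follow from S <= T
   <= |B| <= S. *)
set S := ereal_sup [set ereal_sup _ | x in [set: X]].
set T := ereal_sup [set ereal_sup _ | x in [set: X]].
have ST : (S <= T)%E.
  apply: ge_ereal_sup => _ [x _ <-]; apply: le_ereal_sup_tmp; eexists; first by exists x.
  apply: ereal_sup_le => _ [f f1 <-]; exists f => // i.
  by rewrite f1.
have TB : (T <= (rnorm B)%:E)%E.
  apply: ge_ereal_sup => _ [x _ <-]; apply: ge_ereal_sup => _ [f f1 <-].
  rewrite lee_fin; apply: rnorm_sum_adjoint_le => // v v1.
  rewrite rnorm_bopE.
  have u_inj : injective (fun g : F => val g) by exact: val_inj.
  exact: (le_opnorm_sum_weighted_shifts mu_supp t_group t_mu a X_hausdorff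
    t_free u_inj).
have leS x v : rnorm v <= 1 ->
    ((\sum_(g : F) rnorm (a g (t (val g) x) v))%:E <= S)%E.
  move=> v1.
  have [f f1 fle] := sum_rnorm_le_adjoint (fun g => a g (t (val g) x)) E_neq0 v1.
  apply: le_ereal_sup_tmp; eexists; first by exists x.
  by apply: le_ereal_sup_tmp; eexists; [by exists f|rewrite lee_fin; exact: fle].
have S0 : (0 <= S)%E.
  have := leS point 0; rewrite rnorm0 => /(_ ler01).
  by rewrite big1// => g _; rewrite linear0 rnorm0.
have BS : ((rnorm B)%:E <= S)%E.
  (* A priori [S] is an extended real: +oo is trivial and -oo is excluded by [S0]. For a real value
     k, [leS] is extended from the unit ball to all v by scaling. *)
  case: (S) leS S0 => [k leS k0|_ _|//]; last by rewrite leey.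
  rewrite lee_fin; apply: opnorm_sum_weighted_shifts_le => // x v.
  have [->|v0] := eqVneq v 0.
    by rewrite big1 ?rnorm0 ?mulr0// => g _; rewrite linear0 rnorm0.
  have vgt0 : 0 < rnorm v.
    by rewrite lt_def rnorm_ge0 andbT; apply: contra_neq v0; exact: rnorm_eq0.
  have := leS x ((rnorm v)^-1%:C *: v).
  rewrite rnormZr ger0_norm ?invr_ge0 ?rnorm_ge0// mulVf ?gt_eqF// => /(_ (lexx _)).
  rewrite lee_fin; under eq_bigr do rewrite linearZ rnormZr.
  by rewrite -mulr_sumr gtr0_norm ?invr_gt0// ler_pdivrMl// mulrC.
by split; apply/eqP; rewrite eq_le ?BS ?ST ?(le_trans TB BS)// (le_trans ST TB).
Qed.
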